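(* Let $W=(W_1,\ldots,W_n)$ be an injective weighted left multi-shift associated with weights $\{\mu_\beta\}_{|\beta|\ge1}$ for which there is a nonempty subset $\Omega\subset\{1,\ldots,n\}$ such that $$\lim_{\alpha\to\infty}(\mu_{g_i\alpha}-\mu_\alpha)=0,\qquad i\in\Omega.$$ If $\pi:C^*(W)\to B(\mathcal K)$ is a unital $*$-representation of $C^*(W)$ on a separable Hilbert space $\mathcal K$, then $\pi$ decomposes into a direct sum $\pi=\pi_0\oplus\pi_1$ on $\mathcal K=\mathcal K_0\oplus\mathcal K_1$, where $\pi_0$ and $\pi_1$ are disjoint representations of $C^*(W)$ on the Hilbert spaces $$\mathcal K_0:=\overline{\mathrm{span}}\{\pi(X)\mathcal K:\ X\in\mathbf K(F^2(H_n))\}\quad\text{and}\quad\mathcal K_1:=\mathcal K_0^\perp,$$ respectively, where $\mathbf K(F^2(H_n))$ is the ideal of compact operators in $B(F^2(H_n))$. Moreover, up to an isomorphism, $$\mathcal K_0\simeq F^2(H_n)\otimes\mathcal G,\qquad \pi_0(X)=X\otimes I_{\mathcal G}\quad\text{for } X\in C^*(W),$$ for some Hilbert space $\mathcal G$, and $\pi_1$ is a $*$-representation which annihilates the compact operators in $C^*(W)$ and $$V_i^*V_i=\sum_{j=1}^nV_jV_j^*,\qquad i\in\Omega,$$ where $V_j:=\pi_1(W_j)$. If $\pi'$ is another unital $*$-representation of $C^*(W)$ on a separable Hilbert space $\mathcal K'$, with corresponding decomposition $\pi'=\pi_0'\oplus\pi_1'$ and corresponding Hilbert space $\mathcal G'$,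 then $\pi$ is unitarily equivalent to $\pi'$ if and only if $\dim\mathcal G=\dim\mathcal G'$ and $\pi_1$ is unitarily equivalent to $\pi_1'$.
   Context: Let $n\ge 1$ and let $\mathbb F_n^+$ be the unital free semigroup on generators $g_1,\ldots,g_n$ with identity $g_0$; $|\alpha|$ is the length of $\alpha$. $F^2(H_n)$ is the full Fock space, a Hilbert space with orthonormal basis $\{e_\alpha\}_{\alpha\in\mathbb F_n^+}$. The weighted left multi-shift associated with weights $\mu_\beta\ge0$ ($|\beta|\ge1$) satisfying $\sup_\alpha\mu_{g_i\alpha}<\infty$ for each $i$ (standing assumption) is $W=(W_1,\ldots,W_n)$, $W_ie_\alpha=\mu_{g_i\alpha}e_{g_i\alpha}$. $W$ is injective if each $W_i$ is injective, equivalently all $\mu_\beta>0$. $C^*(W)$ is the $C^*$-algebra generated by $W_1,\ldots,W_n$ and the identity; under the hypotheses it contains $\mathbf K(F^2(H_n))$. Limits as $\alpha\to\infty$ are along $\mathbb F_n^+$ with $|\alpha|\to\infty$. *)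

(* Defs.v *)
From HB Require Import structures.
From mathcomp Require Import all_boot all_order all_algebra.
From mathcomp Require Import all_classical all_reals all_analysis.
From mathcomp Require Import complex ring lra.

Set Implicit Arguments.
Unset Strict Implicit.
Unset Printing Implicit Defensive.

Import Order.TTheory GRing.Theory Num.Theory.
Import numFieldNormedType.Exports.

Local Open Scope classical_set_scope.
Local Open Scope complex_scope.
Local Open Scope ring_scope.

(* The inner product is linear in its first argument and conjugate-linear in
   the second; the norm takes its values in R[i]. *)
Record hilbertType (R : realType) := Hilbert {
  hcarrier :> completeNormedModType R[i];
  hdot : {dot hcarrier for (@Num.conj R[i])};
  hnormE : forall x : hcarrier, `|x| ^+ 2 = hdot x x }.

Notation "''[' x , y ]" := (hdot _ x y)
  (at level 0, format "''[' x ,  y ]") : ring_scope.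

Section HilbertTheory.
Context {R : realType} {H : hilbertType R}.
Implicit Types x y z : H.

Lemma hdotDl x y z : '[x + y, z] = '[x, z] + '[y, z].
Proof. exact: linearDl. Qed.

Lemma hdotDr x y z : '[x, y + z] = '[x, y] + '[x, z].
Proof. exact: linearDr. Qed.

Lemma hdotZl a x y : '[a *: x, y] = a * '[x, y].
Proof. exact: linearZl_LR. Qed.

Lemma hdotZr a x y : '[x, a *: y] = a^* * '[x, y].
Proof. exact: linearZr_LR. Qed.

Lemma hdotNl x y : '[- x, y] = - '[x, y].
Proof. exact: linearNl. Qed.

Lemma hdotNr x y : '[x, - y] = - '[x, y].
Proof. exact: linearNr. Qed.

Lemma hdotC x y : '[x, y] = ('[y, x])^*.
Proof. by rewrite (hermC (hdot H)) expr0 mul1r. Qed.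

Lemma hdot0l x : '[0, x] = 0.
Proof. exact: linear0l. Qed.

Lemma hdot_inj x y : (forall z, '[z, x] = '[z, y]) -> x = y.
Proof.
move=> xy; apply/eqP; rewrite -subr_eq0 -normr_eq0 -sqrf_eq0 hnormE.
by rewrite hdotDr hdotNr xy subrr.
Qed.

Lemma hnorm_sqrD x y : `|x + y| ^+ 2 = `|x| ^+ 2 + `|y| ^+ 2 + ('[x, y] + ('[x, y])^*).
Proof. by rewrite !hnormE dnormD. Qed.

Lemma hCauchySchwarz x y : `|'[x, y]| <= `|x| * `|y|.
Proof.
have [->|y0] := eqVneq y 0.
  by rewrite (hdotC x) hdot0l conjC0 !normr0 mulr0.
have y_gt0 : 0 < '[y, y] by rewrite dnorm_gt0.
rewrite -(@ler_pXn2r _ 2) ?nnegrE ?mulr_ge0// exprMn !hnormE normCK.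
have := dnorm_ge0 (hdot H) ('[y, y] *: x - '[x, y] *: y).
rewrite hdotDl !hdotDr !hdotNl !hdotNr !hdotZl !hdotZr.
rewrite -[('[y, y])^*]hdotC -(hdotC y x) (hdotC y x).
set a := '[x, y]; set b := '[y, y]; set c := '[x, x].
rewrite (_ : _ + _ = b * (c * b - a * a^*)); last by ring.
by rewrite pmulr_rge0// subr_ge0.
Qed.

End HilbertTheory.

Record csubspace (R : realType) (H : hilbertType R) := CSubspace {
  cs_set :> set H;
  cs_set0 : cs_set 0;
  cs_set_lin : forall (a : R[i]) x y,
    cs_set x -> cs_set y -> cs_set (a *: x + y);
  cs_closed : closed cs_set }.

Section ClosedSpan.
Context {R : realType} {H : hilbertType R}.
Implicit Types (S : set H) (x y : H).

Definition lin_span S : set H :=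
  [set x | exists (m : nat) (c : 'I_m -> R[i]) (s : 'I_m -> H),
    (forall k, S (s k)) /\ x = \sum_(k < m) c k *: s k].

Lemma lin_span0 S : lin_span S 0.
Proof.
by exists 0%N, (fun=> 0), (fun=> 0); split=> [[]//|]; rewrite big_ord0.
Qed.

Lemma lin_span_lin S (a : R[i]) x y :
  lin_span S x -> lin_span S y -> lin_span S (a *: x + y).
Proof.
move=> [m [c [s [Ss ->]]]] [p [d [t [St ->]]]].
exists (m + p)%N.
exists (fun k : 'I_(m + p) => match fintype.split k with inl i => a * c i | inr j => d j end).
exists (fun k : 'I_(m + p) => match fintype.split k with inl i => s i | inr j => t j end).
split=> [k|]; first by case: (fintype.split k).
rewrite big_split_ord/= scaler_sumr; congr (_ + _); apply: eq_bigr => k _.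
  by rewrite (unsplitK (inl k)) scalerA.
by rewrite (unsplitK (inr k)).
Qed.

Lemma closure_lin S (a : R[i]) x y :
  closure (lin_span S) x -> closure (lin_span S) y ->
  closure (lin_span S) (a *: x + y).
Proof.
move=> clx cly B.
have h : (fun z : H * H => a *: z.1 + z.2) @ (x, y) --> a *: x + y.
  apply: cvgD; last exact: cvg_snd.
  by apply: cvgZr; exact: cvg_fst.
move=> /h [[/= U V] [/clx[u [Su Uu]] /cly[v [Sv Vv]]] UVB].
exists (a *: u + v); split; first exact: lin_span_lin.
exact: (UVB (u, v)).
Qed.

Definition closed_span S : csubspace H :=
  CSubspace (subset_closure (lin_span0 S)) (@closure_lin S)
    (@closed_closure _ (lin_span S)).

Lemma hdotl_continuous y : continuous (fun x : H => '[x, y] : R[i]^o).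
Proof.
move=> x; apply/cvgrPdist_le => e e0.
have y1 : 0 < `|y| + 1 by rewrite ltr_wpDl.
near=> z.
rewrite -hdotNl -hdotDl (le_trans (hCauchySchwarz _ _))//.
apply: (@le_trans _ _ (`|x - z| * (`|y| + 1))).
  by rewrite ler_wpM2l// lerDl.
rewrite -ler_pdivlMr//; near: z.
by apply: cvgr_dist_le => //; exact: divr_gt0.
Unshelve. all: by end_near. Qed.

Definition orth_set (M : set H) : set H :=
  [set x | forall y, M y -> '[x, y] = 0].

Lemma orth_set0 M : orth_set M 0.
Proof. by move=> y _; rewrite hdot0l. Qed.

Lemma orth_set_lin M (a : R[i]) x y :
  orth_set M x -> orth_set M y -> orth_set M (a *: x + y).
Proof.
by move=> Mx My z Mz; rewrite hdotDl hdotZl Mx// My// mulr0 addr0.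
Qed.

Lemma orth_closed M : closed (orth_set M).
Proof.
rewrite (_ : orth_set M =
  \bigcap_(y in M) (fun x : H => '[x, y] : R[i]^o) @^-1` [set 0])//.
apply: closed_bigI => y My; apply: closed_comp => [x _|].
  exact: hdotl_continuous.
apply: accessible_closed_set1; apply: hausdorff_accessible.
exact: norm_hausdorff.
Qed.

Definition orth_compl (M : set H) : csubspace H :=
  CSubspace (@orth_set0 M) (@orth_set_lin M) (@orth_closed M).

End ClosedSpan.

(* A closed subspace, viewed as a Hilbert space in its own right. *)
Section Subspace.
Context {R : realType} {H : hilbertType R} (M : csubspace H).

Definition cs_pred : {pred H} := fun x => x \in cs_set M.

Fact cs_submod_closed : submod_closed cs_pred.
Proof.
split; first by rewrite inE; exact: cs_set0.
by move=> a x y; rewrite !inE => Mx My; exact: cs_set_lin.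
Qed.

HB.instance Definition _ :=
  GRing.isSubmodClosed.Build R[i] H cs_pred cs_submod_closed.

Record csub := CSub { csval : H; csvalP : csval \in cs_pred }.

HB.instance Definition _ := [isSub for csval].
HB.instance Definition _ := [Choice of csub by <:].
HB.instance Definition _ := [SubChoice_isSubLmodule of csub by <:].

Definition csub_norm (x : csub) : R[i] := `|csval x|.

Fact csub_normD x y : csub_norm (x + y) <= csub_norm x + csub_norm y.
Proof. exact: ler_normD. Qed.

Fact csub_normZ (a : R[i]) x : csub_norm (a *: x) = `|a| * csub_norm x.
Proof. exact: normrZ. Qed.

Fact csub_norm0 x : csub_norm x = 0 -> x = 0.
Proof. by move/normr0_eq0 => x0; exact: val_inj. Qed.

HB.instance Definition _ :=
  Lmodule_isNormed.Build R[i] csub csub_normD csub_normZ csub_norm0.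

Lemma csval_norm (x : csub) : `|csval x| = `|x|.
Proof. by []. Qed.

Lemma csub_complete (F : set_system csub) :
  ProperFilter F -> cauchy F -> cvg F.
Proof.
move=> FF /cauchy_ballP cF.
have cG : cauchy (csval @ F).
  apply/cauchy_ballP => eps eps0; have [[A B] /= [FA FB] AB] := cF eps eps0.
  exists (csval @` A, csval @` B) => /=.
    by split; [move: FA|move: FB]; apply: filterS => x Ax; exists x.
  move=> [_ _] /= [[x Ax <-] [y By <-]].
  move: (AB (x, y) (conj Ax By)) => /=.
  by rewrite -!ball_normE.
have [l Fl] : exists l : H, csval @ F --> l.
  by apply/cvg_ex; exact: cauchy_cvg.
have Ml : cs_set M l.
  apply: (@closed_cvg _ _ F _ csval (cs_set M) (@cs_closed _ _ M) _ l Fl).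
  by apply: nearW => x; have := csvalP x; rewrite inE.
have Ml' : l \in cs_pred by rewrite inE.
apply/cvg_ex; exists (CSub Ml'); apply/cvgrPdist_lt => eps eps0.
have /cvgrPdist_lt/(_ _ eps0) := Fl.
exact.
Qed.

HB.instance Definition _ := Uniform_isComplete.Build csub csub_complete.

Definition csub_dot (x y : csub) : R[i] := '[csval x, csval y].

Fact csub_dot_linl y : GRing.linear_for *%R (csub_dot^~ y).
Proof. by move=> a x z; rewrite /csub_dot hdotDl hdotZl. Qed.

Fact csub_dot_linr x :
  GRing.linear_for ((@Num.conj R[i] : _ -> _) \; *%R) (csub_dot x).
Proof. by move=> a y z; rewrite /csub_dot hdotDr hdotZr. Qed.

HB.instance Definition _ :=
  bilinear_isBilinear.Build R[i] csub csub R[i] *%R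
    ((@Num.conj R[i] : _ -> _) \; *%R) csub_dot
    (pair (csub_dot_linl) csub_dot_linr).

Fact csub_dot_herm x y :
  csub_dot x y = (-1) ^+ false * (csub_dot y x)^*.
Proof. by rewrite expr0 mul1r; exact: hdotC. Qed.

HB.instance Definition _ :=
  isHermitianSesquilinear.Build R[i] csub false _ csub_dot csub_dot_herm.

Fact csub_dot_gt0 x : x != 0 -> 0 < csub_dot x x.
Proof. by move=> x0; rewrite /csub_dot dnorm_gt0. Qed.

HB.instance Definition _ :=
  isDotProduct.Build R[i] csub csub_dot csub_dot_gt0.

Definition sub_hilbert : hilbertType R :=
  @Hilbert R csub csub_dot (fun x => hnormE (csval x)).

End Subspace.

Record bop (R : realType) (H K : hilbertType R) := Bop {
  bop_fun :> {linear H -> K};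
  bop_cont : continuous bop_fun }.

Section Bop.
Context {R : realType}.
Implicit Types H K L : hilbertType R.

Lemma bopP H K (S T : bop H K) : (forall x, S x = T x) -> S = T.
Proof.
case: S T => [S cS] [T cT] /= ST.
have ?: S = T.
  case: S T {cS cT} ST => [S [[S1] [S2]]] [T [[T1] [T2]]] /= ST.
  have ? : S = T by apply/funext.
  by subst T; rewrite (Prop_irrelevance S1 T1) (Prop_irrelevance S2 T2).
by subst T; congr Bop; exact: Prop_irrelevance.
Qed.

Lemma bop_bounded H K (T : bop H K) :
  exists2 c : R[i], 0 <= c & forall x, `|T x| <= c * `|x|.
Proof.
have /continuous_linear_bounded/linear_boundedP : {for 0, continuous T}.
  exact: bop_cont.
move=> /pinfty_ex_gt0[c c0 cT]; exists c => //; exact: ltW.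
Qed.

Lemma bounded_cont H K (T : {linear H -> K}) (c : R[i]) :
  0 <= c -> (forall x, `|T x| <= c * `|x|) -> continuous T.
Proof.
move=> c0 cT; apply: bounded_linear_continuous; apply/linear_boundedP.
near=> r => x; rewrite (le_trans (cT x))// ler_wpM2r//.
near: r; apply: nbhs_pinfty_ge; exact: ger0_real.
Unshelve. all: by end_near. Qed.

Fact bop_id_cont H : continuous (idfun : {linear H -> H}).
Proof. by move=> x; exact: cvg_id. Qed.

Definition bop_id H : bop H H := Bop (@bop_id_cont H).

Fact bop_comp_cont H K L (S : bop K L) (T : bop H K) : continuous (S \o T).
Proof. by move=> x; apply: continuous_comp; exact: bop_cont. Qed.

Definition bop_comp H K L (S : bop K L) (T : bop H K) : bop H L :=
  Bop (@bop_comp_cont H K L S T).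

Fact bop_lin_cont H K (a : R[i]) (S T : bop H K) :
  continuous ((a \*: S) \+ T : {linear H -> K}).
Proof.
move=> x; apply: cvgD; last exact: bop_cont.
by apply: cvgZr; exact: bop_cont.
Qed.

(* a S + T *)
Definition bop_lin H K (a : R[i]) (S T : bop H K) : bop H K :=
  Bop (@bop_lin_cont H K a S T).

End Bop.

Lemma riesz (R : realType) (H : hilbertType R) (f : H -> R[i]) (c : R[i]) :
  (forall a x y, f (a *: x + y) = a * f x + f y) ->
  0 <= c -> (forall x, `|f x| <= c * `|x|) ->
  exists u, forall x, f x = '[x, u].
Proof.
move=> flin c0 fc.
have f0 : f 0 = 0.
  by apply/eqP; rewrite -normr_le0 (le_trans (fc 0))// normr0 mulr0.
have fD x y : f (x + y) = f x + f y by rewrite -[x]scale1r flin mul1r scale1r.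
have fZ a x : f (a *: x) = a * f x by rewrite -[a *: x]addr0 flin f0 addr0.
have addC_real (z : R[i]) : z + z^* \is Num.real.
  by apply/CrealP; rewrite rmorphD/= conjCK addrC.
pose J x : R[i] := `|x| ^+ 2 - (f x + (f x)^*).
have J_real x : J x \is Num.real.
  by rewrite rpredB ?addC_real ?rpredX ?normr_real.
pose j x : R := complex.Re (J x).
have jE x : (j x)%:C = J x by exact: RRe_real.
have J_ge x : - c ^+ 2 <= J x.
  rewrite -subr_ge0 /J.
  have h : f x + (f x)^* <= c * `|x| + c * `|x|.
    rewrite (le_trans (real_ler_norm (addC_real _)))//.
    by rewrite (le_trans (ler_normD _ _))// norm_conjC lerD.
  have c_real : c \is Num.real by exact: ger0_real.
  apply: (@le_trans _ _ ((`|x| - c) ^+ 2)).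
    by rewrite real_exprn_even_ge0// rpredB ?normr_real ?c_real.
  rewrite -subr_ge0.
  rewrite (_ : _ - _ = (c * `|x| + c * `|x|) - (f x + (f x)^*)); last by ring.
  by rewrite subr_ge0.
have has_inf_j : has_inf (range j).
  split; first by exists (j 0), 0.
  exists (complex.Re (- c ^+ 2)) => _ [x _ <-].
  by have := J_ge x; rewrite lecE => /andP[].
pose D : R[i] := (inf (range j))%:C.
have D_le x : D <= J x.
  by rewrite -jE lecR; apply: ge_inf; [exact: has_inf_j.2|exists x].
have D_adh (eps : R[i]) : 0 < eps -> exists x, J x < D + eps.
  move=> eps0; have e0 : 0 < complex.Re eps.
    by move: eps0; rewrite ltcE => /andP[].
  have [_ [x _ <-] xlt] := inf_adherent e0 has_inf_j.
  exists x; rewrite -jE -[eps]RRe_real ?gtr0_real// -rmorphD/= ltcR.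
  exact: xlt.
have par x y : `|x - y| ^+ 2 =
    J x *+ 2 + J y *+ 2 - J (2%:R^-1 *: (x + y)) *+ 4.
  rewrite /J fZ fD normrZ exprMn !rmorphM/= !rmorphD/= !hnorm_sqrD normrN.
  rewrite hdotNr rmorphN/= ger0_norm// fmorphV rmorph_nat.
  by field.
have close (eps : R[i]) x y :
    J x < D + eps -> J y < D + eps -> `|x - y| ^+ 2 < eps *+ 4.
  move=> xe ye; rewrite par ltrBlDr.
  apply: (@lt_le_trans _ _ ((D + eps) *+ 2 + (D + eps) *+ 2)).
    by rewrite ltrD// ltrMn2r.
  rewrite (_ : _ + _ = eps *+ 4 + D *+ 4); last by ring.
  by rewrite lerD2l lerMn2r/= D_le.
pose B (eps : R[i]) : set H := [set x | J x < D + eps].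
pose F := filter_from [set eps : R[i] | 0 < eps] B.
have FF : ProperFilter F.
  apply: filter_from_proper; last by move=> eps /= /D_adh[x Jx]; exists x.
  apply: filter_from_filter; first by exists 1; exact: ltr01.
  move=> e1 e2 /= e1_gt0 e2_gt0.
  have r1 := gtr0_real e1_gt0; have r2 := gtr0_real e2_gt0.
  have [e12|/ltW e21] := real_leP r1 r2.
    exists e1 => // x Jx; split=> //; rewrite /B/=.
    by rewrite (lt_le_trans Jx)// lerD2l.
  exists e2 => // x Jx; split=> //; rewrite /B/=.
  by rewrite (lt_le_trans Jx)// lerD2l.
have cF : cauchy F.
  apply: cauchy_exP => e e0.
  have d0 : 0 < e ^+ 2 / 4%:R by rewrite divr_gt0// exprn_gt0.
  have [v Jv] := D_adh _ d0.
  exists v; exists (e ^+ 2 / 4%:R) => // x Jx.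
  rewrite -ball_normE/=.
  rewrite -(@ltr_pXn2r _ 2) ?nnegrE ?(ltW e0)//.
  rewrite (lt_le_trans (close _ _ _ Jv Jx))//.
  by rewrite [leLHS](_ : _ = e ^+ 2) ?lexx//; field.
have [u Fu] : exists u : H, F --> u by apply/cvg_ex; exact: cauchy_cvg.
exists u => w; apply/eqP; rewrite -subr_eq0 -normr_eq0.
set g := `|_|; apply: contraT => g_neq0.
have g0 : 0 < g by rewrite lt_def g_neq0 normr_ge0.
have w1 : 0 < 1 + `|w| by rewrite ltr_pwDl.
have w2 : 0 < 1 + `|w| ^+ 2 by rewrite ltr_pwDl// exprn_ge0.
pose eps := (g / 2%:R) ^+ 2 / (1 + `|w| ^+ 2).
have eps0 : 0 < eps by rewrite divr_gt0// exprn_gt0// divr_gt0.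
pose del := g / 4%:R / (1 + `|w|).
have del0 : 0 < del by rewrite !divr_gt0.
have Fball : F (ball u del) := Fu _ (nbhsx_ballx u del del0).
have FB : F (B eps) by exists eps.
have [v [uv Jv]] := filter_ex (filterI Fball FB).
move: uv; rewrite -ball_normE/= => uv.
pose q := '[w, v] - f w.
have Jvar (t : R[i]) : J (v - t *: w) =
    J v - (t * q + (t * q)^*) + `|t| ^+ 2 * `|w| ^+ 2.
  rewrite -scaleNr [v + _]addrC /J flin hnorm_sqrD normrZ normrN exprMn hdotZl /q.
  by rewrite !rmorphD !rmorphM/= !rmorphN/= rmorphB/=; ring.
pose s := (1 + `|w| ^+ 2)^-1.
have s0 : 0 < s by rewrite invr_gt0.
have s_conj : s^* = s by apply/CrealP; exact: gtr0_real.
have qle : `|q| <= g / 2%:R.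
  rewrite -(@ler_pXn2r _ 2) ?nnegrE ?divr_ge0// ?(ltW g0)//.
  rewrite -[leRHS](@divfK _ (1 + `|w| ^+ 2)) ?gt_eqF// -/eps.
  rewrite -ler_pdivrMr// -/s.
  have := D_le (v - (s * q^*) *: w); rewrite Jvar.
  rewrite !rmorphM/= conjCK s_conj.
  rewrite normrM norm_conjC (ger0_norm (ltW s0)) !exprMn.
  rewrite -[s * q^* * q]mulrA [q^* * q]mulrC -[s * q * q^*]mulrA -normCK.
  have sw : s * `|w| ^+ 2 <= 1.
    by rewrite /s mulrC ler_pdivrMr// mul1r lerDr.
  move=> le1; have {}le1 := le_trans le1 (lerD (lerB (ltW Jv) (lexx _)) (lexx _)).
  move: le1; rewrite -subr_ge0.
  have p0 : 0 <= s * `|q| ^+ 2 * (1 - s * `|w| ^+ 2).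
    by rewrite mulr_ge0// ?subr_ge0// mulr_ge0// ?exprn_ge0// ltW.
  move=> h; have := addr_ge0 h p0.
  rewrite (_ : _ + _ = eps - `|q| ^+ 2 * s) ?subr_ge0//.
  by ring.
have : g <= g / 2%:R + g / 4%:R.
  rewrite {1}/g (_ : _ - _ = - q - '[w, u - v]); last first.
    by rewrite /q hdotDr hdotNr; ring.
  rewrite (le_trans (ler_normB _ _))// normrN lerD//.
  rewrite (le_trans (hCauchySchwarz _ _))//.
  apply: (@le_trans _ _ ((1 + `|w|) * `|u - v|)).
    by rewrite ler_wpM2r// lerDr.
  by rewrite -ler_pdivlMl// mulrC ltW.
rewrite -subr_ge0 (_ : _ - _ = - (g / 4%:R)); last by field.
by rewrite oppr_ge0 lt_geF// divr_gt0.
Qed.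

Lemma adjoint_ex (R : realType) (H K : hilbertType R) (T : bop H K) :
  exists S : bop K H, forall x y, '[T x, y] = '[x, S y].
Proof.
have [c c0 cT] := bop_bounded T.
have h y : exists u, forall x, '[T x, y] = '[x, u].
  apply: (@riesz _ _ (fun x => '[T x, y]) (c * `|y|)).
  - by move=> a x z; rewrite linearP hdotDl hdotZl.
  - exact: mulr_ge0.
  - move=> x; rewrite (le_trans (hCauchySchwarz _ _))//.
    by rewrite mulrAC ler_wpM2r.
pose S y := projT1 (cid (h y)).
have SE x y : '[T x, y] = '[x, S y] by exact: (projT2 (cid (h y)) x).
have Slin : linear S.
  move=> a y z; apply: hdot_inj => x.
  by rewrite -SE hdotDr hdotZr !SE hdotDr hdotZr.
pose mS := GRing.isLinear.Build R[i] K H *:%R S Slin.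
pose S' : {linear K -> H} := HB.pack S mS.
have cS : continuous S'.
  apply: (@bounded_cont _ _ _ S' c c0) => y /=.
  have [->|Sy0] := eqVneq (S y) 0; first by rewrite normr0 mulr_ge0.
  have Sy : 0 < `|S y| by rewrite normr_gt0.
  rewrite -(ler_pM2r Sy) -expr2 hnormE -SE.
  rewrite (le_trans (real_ler_norm _))//.
    by rewrite SE -hnormE rpredX ?normr_real.
  by rewrite (le_trans (hCauchySchwarz _ _))// mulrAC ler_wpM2r.
by exists (Bop cS).
Qed.

Definition adjoint (R : realType) (H K : hilbertType R) (T : bop H K) :
  bop K H := projT1 (cid (adjoint_ex T)).

Lemma adjointE (R : realType) (H K : hilbertType R) (T : bop H K) x y :
  '[T x, y] = '[x, adjoint T y].
Proof. exact: (projT2 (cid (adjoint_ex T))). Qed.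

Section Operators.
Context {R : realType}.
Implicit Types H K G : hilbertType R.

Definition opnorm_le H K (T : bop H K) (c : R[i]) :=
  forall x, `|T x| <= c * `|x|.

Definition compact_op H K (T : bop H K) :=
  precompact (T @` [set x | `|x| <= 1]).

Definition unitary H K (U : bop H K) :=
  (forall x y, '[U x, U y] = '[x, y]) /\ range U = setT.

Definition separable H := exists2 S : set H, countable S & dense S.

Definition orthonormal_basis H (I : eqType) (e : I -> H) :=
  (forall a b, '[e a, e b] = (a == b)%:R) /\
  cs_set (closed_span (range e)) = setT.

Definition hdim_eq H K := exists (I J : choiceType) (e : I -> H) (f : J -> K),
  [/\ orthonormal_basis e, orthonormal_basis f & ([set: I] #= [set: J])%card].

(* Unital C*-subalgebras of B(H). *)
Definition cstar_subalgebra H (A : set (bop H H)) :=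
  [/\ A (bop_id H),
      forall a X Y, A X -> A Y -> A (bop_lin a X Y),
      forall X Y, A X -> A Y -> A (bop_comp X Y),
      forall X, A X -> A (adjoint X) &
      forall X, (forall eps : R[i], 0 < eps ->
        exists2 Y, A Y & opnorm_le (bop_lin (- 1) Y X) eps) -> A X].

Definition cstar_gen H (S : set (bop H H)) : set (bop H H) :=
  \bigcap_(A in [set A | cstar_subalgebra A /\ S `<=` A]) A.

(* A representation of the C*-algebra A of operators on H is a function on all
   of B(H); its values outside A are irrelevant. *)
Definition unital_star_rep H (A : set (bop H H)) K
    (pi : bop H H -> bop K K) :=
  [/\ pi (bop_id H) = bop_id K,
      forall a X Y, A X -> A Y ->
        pi (bop_lin a X Y) = bop_lin a (pi X) (pi Y),
      forall X Y, A X -> A Y -> pi (bop_comp X Y) = bop_comp (pi X) (pi Y) &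
      forall X, A X -> pi (adjoint X) = adjoint (pi X)].

Definition unitarily_equivalent H (A : set (bop H H)) K K'
    (pi : bop H H -> bop K K) (pi' : bop H H -> bop K' K') :=
  exists2 U : bop K K', unitary U &
    forall X, A X -> bop_comp U (pi X) = bop_comp (pi' X) U.

Definition subrep H (A : set (bop H H)) K (pi : bop H H -> bop K K)
    (M : csubspace K) (rho : bop H H -> bop (sub_hilbert M) (sub_hilbert M)) :=
  forall X, A X -> forall x : sub_hilbert M, csval (rho X x) = pi X (csval x).

(* No nonzero subrepresentations of pi and pi' are unitarily equivalent. *)
Definition disjoint_reps H (A : set (bop H H)) K K'
    (pi : bop H H -> bop K K) (pi' : bop H H -> bop K' K') :=
  forall (M : csubspace K) (M' : csubspace K')
    (rho : bop H H -> bop (sub_hilbert M) (sub_hilbert M))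
    (rho' : bop H H -> bop (sub_hilbert M') (sub_hilbert M')),
  subrep A pi rho -> subrep A pi' rho' ->
  (exists2 x, cs_set M x & x != 0) ->
  ~ unitarily_equivalent A rho rho'.

Definition rep_direct_sum H (A : set (bop H H)) K (pi : bop H H -> bop K K)
    (M N : csubspace K)
    (rho : bop H H -> bop (sub_hilbert M) (sub_hilbert M))
    (sigma : bop H H -> bop (sub_hilbert N) (sub_hilbert N)) :=
  [/\ forall (x : sub_hilbert M) (y : sub_hilbert N),
        '[csval x, csval y] = 0,
      forall z : K, exists (x : sub_hilbert M) (y : sub_hilbert N),
        z = csval x + csval y &
      forall X, A X -> forall (x : sub_hilbert M) (y : sub_hilbert N),
        pi X (csval x + csval y) = csval (rho X x) + csval (sigma X y)].

Definition compact_part H (A : set (bop H H)) K (pi : bop H H -> bop K K) :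
    csubspace K :=
  closed_span [set z | exists X y, [/\ A X, compact_op X & z = pi X y]].

Definition singular_part H (A : set (bop H H)) K (pi : bop H H -> bop K K) :
    csubspace K :=
  orth_compl (compact_part A pi).

(* The Hilbert space tensor product, which these data determine up to a unique
   compatible unitary. *)
Record hilbert_tensor H G := HilbertTensor {
  ht_space :> hilbertType R;
  ht_map : {bilinear H -> G -> ht_space};
  ht_dot : forall x x' y y',
    '[ht_map x y, ht_map x' y'] = '[x, x'] * '[y, y'];
  ht_total : cs_set (closed_span [set ht_map p.1 p.2 | p in setT]) = setT }.

Definition is_tensor_op H G (T : hilbert_tensor H G) (X : bop H H)
    (Y : bop G G) (Z : bop T T) :=
  forall x y, Z (ht_map T x y) = ht_map T (X x) (Y y).

(* K is H (x) G and pi X is X (x) I_G, up to a unitary. *)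
Definition ampliation H (A : set (bop H H)) K (pi : bop H H -> bop K K) G :=
  exists (T : hilbert_tensor H G) (rho : bop H H -> bop T T),
    (forall X, A X -> is_tensor_op X (bop_id G) (rho X)) /\
    unitarily_equivalent A pi rho.

(* Words are lists of letters: g_i alpha is i :: alpha, and mu [::] plays no
   role. *)
Definition weighted_left_multishift n H (e : seq 'I_n -> H)
    (mu : seq 'I_n -> R) (W : 'I_n -> bop H H) :=
  [/\ forall b, (1 <= size b)%N -> 0 <= mu b,
      forall i, has_ubound (range (fun a => mu (i :: a))) &
      forall i a, W i (e a) = (mu (i :: a))%:C *: e (i :: a)].

End Operators.

Definition words_infty n : set_system (seq 'I_n) :=
  filter_from setT (fun N => [set a : seq 'I_n | (N <= size a)%N]).
Arguments words_infty n : clear implicits.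

(* Main.v *)
(** Write [x (x) y] for the rank one operator [z |-> <z, y> x] and [o] for the vacuum vector
    [e [::]].  For [i] in [Omega] the defect [W_i^* W_i - sum_j W_j W_j^*] is diagonal with
    eigenvalues tending to zero, by the limit hypothesis, and with a positive eigenvalue at
    [o].  Polynomials in it and in [sum_j W_j W_j^*] converge to the projection onto [o], so
    that [A] contains every rank one operator.

    Given a representation [pi], the operators [E_x = pi (x (x) o)] satisfy
    [<E_x g, E_y h> = <x, y> <pi (o (x) o) g, h>] and [pi X E_x = E_(X x)].  Their
    ranges span the compact part, because compact operators are norm limits of finite rank
    operators, and [x (x) g |-> E_x g] identifies it with [F2 (x) G] for [G] the range of the
    projection [pi (o (x) o)].  On the orthogonal complement the compact operators act as
    zero, and so does the defect, a norm limit of finite rank operators.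

    An intertwining unitary restricts to the ranges of the vacuum projections and to the
    singular parts; conversely, equality of Gram matrices glues unitaries on these two pieces
    to an intertwining unitary.  The only automatic continuity needed is [|pi X| <= 2 |X|],
    which follows from the positivity of [1 - X^* X] for [|X| <= 1/2]. *)

Require Import Defs.
From HB Require Import structures.
From mathcomp Require Import all_boot all_order all_algebra.
From mathcomp Require Import all_classical all_reals all_analysis.
From mathcomp Require Import complex ring.

Set Implicit Arguments.
Unset Strict Implicit.
Unset Printing Implicit Defensive.

Import Order.TTheory GRing.Theory Num.Theory.
Import numFieldNormedType.Exports.

Local Open Scope classical_set_scope.
Local Open Scope complex_scope.
Local Open Scope ring_scope.

(** * Hilbert spaces: completeness, projections, total families *)

Section HilbertSpaces.
Context {R : realType}.
Implicit Types H K L : hilbertType R.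

Lemma hdotBl H (x y z : H) : '[x - y, z] = '[x, z] - '[y, z].
Proof. by rewrite hdotDl hdotNl. Qed.

Lemma hdotBr H (x y z : H) : '[x, y - z] = '[x, y] - '[x, z].
Proof. by rewrite hdotDr hdotNr. Qed.

Lemma hdot0r H (x : H) : '[x, 0] = 0.
Proof. by rewrite hdotC hdot0l conjC0. Qed.

Lemma hdot_injl H (x y : H) : (forall z, '[x, z] = '[y, z]) -> x = y.
Proof. by move=> xy; apply: hdot_inj => z; rewrite hdotC xy -hdotC. Qed.

Lemma hdot_eq0 H (x : H) : '[x, x] = 0 -> x = 0.
Proof.
by move=> xx; apply/eqP; rewrite -normr_eq0 -sqrf_eq0 hnormE xx.
Qed.

Lemma hdot_suml H I (s : seq I) (F : I -> H) y :
  '[\sum_(i <- s) F i, y] = \sum_(i <- s) '[F i, y].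
Proof. by apply: (big_morph (fun x => '[x, y])) => [x z|]; rewrite (hdotDl, hdot0l). Qed.

Lemma hdot_sumr H I (s : seq I) (F : I -> H) y :
  '[y, \sum_(i <- s) F i] = \sum_(i <- s) '[y, F i].
Proof. by apply: (big_morph (fun x => '[y, x])) => [x z|]; rewrite (hdotDr, hdot0r). Qed.

Lemma hnorm_le_dot H K (x : H) (y : K) (c : R[i]) :
  0 <= c -> '[x, x] <= c ^+ 2 * '[y, y] -> `|x| <= c * `|y|.
Proof.
move=> c0; rewrite -!hnormE -exprMn ler_pXn2r ?nnegrE ?mulr_ge0//.
Qed.

Lemma hnorm_eq_dot H K (x : H) (y : K) : '[x, x] = '[y, y] -> `|x| = `|y|.
Proof.
by move=> xy; apply/eqP; rewrite -(@eqrXn2 _ 2)// !hnormE xy.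
Qed.

(** Polarisation: comparing the norms of [a *: f x + f y] and [a *: x + y] shows that the real part
    of [a * d] vanishes for every scalar [a], where [d] is the difference of the two inner
    products. *)
Lemma linear_isometry_dot H K (f : H -> K) :
  linear f -> (forall x, `|f x| = `|x|) -> forall x y, '[f x, f y] = '[x, y].
Proof.
move=> flin fiso x y; apply/eqP; rewrite -subr_eq0; set d := _ - _.
have re (a : R[i]) : a * d + (a * d)^* = 0.
  have := hnorm_sqrD (a *: f x) (f y).
  rewrite -flin fiso hnorm_sqrD !normrZ !fiso => /addrI/eqP.
  rewrite !hdotZl eq_sym -subr_eq0 => /eqP <-.
  by rewrite /d mulrBr rmorphB/=; ring.
(* With [a] the conjugate of [d], the product [a * d] is the squared modulus of [d]. *)
have := re d^*; rewrite -normCKC.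
rewrite rmorphXn/= conj_normC -mulr2n => /eqP.
by rewrite mulrn_eq0/= sqrf_eq0 normr_eq0.
Qed.

(** The sets [B e] form the base of a Cauchy filter, whose limit is the point sought. This form of
    completeness serves both the extension of isometries and the limits of operators. *)
Lemma complete_approx H (B : R[i] -> set H) :
  (forall e, 0 < e -> B e !=set0) ->
  (forall e1 e2, e1 <= e2 -> B e1 `<=` B e2) ->
  (forall e y z, 0 < e -> B e y -> B e z -> `|y - z| <= e *+ 2) ->
  exists y, forall e, 0 < e -> exists2 z, B e z & `|y - z| < e.
Proof.
move=> B0 Bmono Bcauchy.
pose F := filter_from [set e : R[i] | 0 < e] B.
have FF : ProperFilter F.
  apply: filter_from_proper; last by move=> e /=; exact: B0.
  apply: filter_from_filter; first by exists 1; exact: ltr01.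
  move=> e1 e2 /= e1_gt0 e2_gt0.
  have [e12|/ltW e21] := real_leP (gtr0_real e1_gt0) (gtr0_real e2_gt0).
    by exists e1 => // x Bx; split=> //; exact: Bmono Bx.
  by exists e2 => // x Bx; split=> //; exact: Bmono Bx.
have cF : cauchy F.
  apply: cauchy_exP => e e0.
  have d0 : 0 < e / 4%:R by rewrite divr_gt0.
  have [v Bv] := B0 _ d0; exists v; exists (e / 4%:R) => // z Bz.
  rewrite -ball_normE/=; apply: le_lt_trans (Bcauchy _ _ _ d0 Bv Bz) _.
  rewrite (_ : _ *+ 2 = e / 2%:R); last by field.
  by rewrite ltr_pdivrMr// ltr_pMr// ltr1n.
have [u Fu] : exists u : H, F --> u by apply/cvg_ex; exact: cauchy_cvg.
exists u => e e0.
have Fball : F (ball u e) := Fu _ (nbhsx_ballx u e e0).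
have FB : F (B e) by exists e.
have [z [uz Bz]] := filter_ex (filterI Fball FB).
by exists z => //; move: uz; rewrite -ball_normE.
Qed.

Lemma bop_ext_ex H K (f : H -> K) (c : R[i]) :
  linear f -> 0 <= c -> (forall x, `|f x| <= c * `|x|) ->
  exists T : bop H K, forall x, T x = f x.
Proof.
move=> flin c0 fc.
pose mf := GRing.isLinear.Build R[i] H K *:%R f flin.
pose f' : {linear H -> K} := HB.pack f mf.
by exists (Bop (@bounded_cont _ _ _ f' c c0 fc)).
Qed.

Section ClosedSubspaces.
Variables (H : hilbertType R).

Lemma bop_incl_ex (M : csubspace H) :
  exists T : bop (sub_hilbert M) H, forall x, T x = csval x.
Proof. by apply: (@bop_ext_ex _ _ _ 1) => // x; rewrite mul1r. Qed.

Definition bop_incl (M : csubspace H) : bop (sub_hilbert M) H :=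
  projT1 (cid (bop_incl_ex M)).

Lemma bop_inclE (M : csubspace H) x : bop_incl M x = csval x.
Proof. exact: (projT2 (cid (bop_incl_ex M)) x). Qed.

Lemma csval_mem (M : csubspace H) (x : sub_hilbert M) : cs_set M (csval x).
Proof. by have := csvalP x; rewrite inE. Qed.

Lemma csval_ex (M : csubspace H) x :
  cs_set M x -> exists y : sub_hilbert M, csval y = x.
Proof.
move=> Mx; have Mx' : x \in cs_pred M by rewrite inE.
by exists (CSub Mx').
Qed.

Lemma hdot_csval (M : csubspace H) (x y : sub_hilbert M) :
  '[csval x, csval y] = '[x, y].
Proof. by []. Qed.

(** The adjoint of an isometric inclusion is the orthogonal projection, so orthogonal decompositions
    follow from the existence of adjoints. *)
Definition bop_proj (M : csubspace H) : bop H (sub_hilbert M) :=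
  adjoint (bop_incl M).

Lemma bop_projE (M : csubspace H) z (x : sub_hilbert M) :
  '[bop_proj M z, x] = '[z, csval x].
Proof. by rewrite hdotC -adjointE bop_inclE -hdotC. Qed.

Lemma csvalK (M : csubspace H) : cancel (@csval _ _ M) (bop_proj M).
Proof. by move=> x; apply: (@hdot_injl (sub_hilbert M)) => z; rewrite bop_projE. Qed.

Lemma bop_projK (M : csubspace H) z : cs_set M z -> csval (bop_proj M z) = z.
Proof. by move=> /csval_ex[x <-]; rewrite csvalK. Qed.

Lemma bop_proj_orth (M : csubspace H) z : orth_set M (z - csval (bop_proj M z)).
Proof.
by move=> _ /csval_ex[x <-]; rewrite hdotBl hdot_csval bop_projE subrr.
Qed.

Lemma closed_span_incl (S : set H) : S `<=` closed_span S.
Proof.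
move=> x Sx; apply: subset_closure; exists 1%N, (fun=> 1), (fun=> x).
by split=> //; rewrite big_ord1 scale1r.
Qed.

Lemma csubspaceD (M : csubspace H) x y : cs_set M x -> cs_set M y -> cs_set M (x + y).
Proof. by move=> Mx My; rewrite -[x]scale1r; exact: cs_set_lin. Qed.

Lemma csubspaceZ (M : csubspace H) (a : R[i]) x : cs_set M x -> cs_set M (a *: x).
Proof.
by move=> Mx; rewrite -[_ *: _]addr0; apply: cs_set_lin => //; exact: cs_set0.
Qed.

Lemma closed_span_sub (S : set H) (M : csubspace H) :
  S `<=` M -> closed_span S `<=` M.
Proof.
move=> SM; have SM' : lin_span S `<=` M.
  move=> _ [m [c [s [Ss ->]]]]; apply: big_ind; first exact: cs_set0.
    exact: csubspaceD.
  by move=> k _; apply: csubspaceZ; exact/SM/Ss.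
move=> x Sx; rewrite [X in X x](iffLR (closure_id _) (@cs_closed _ _ M)).
exact: (closureS SM') Sx.
Qed.

(** The double orthogonal complement: the residual of [x] after projection onto the closed span is
    orthogonal to [S], hence to [x] by assumption, and also to the projection of [x], so it is
    zero. *)
Lemma closed_spanP (S : set H) x :
  cs_set (closed_span S) x <-> forall v, (forall s, S s -> '[s, v] = 0) -> '[x, v] = 0.
Proof.
split=> [Sx v vS|Sx].
  suff : closed_span S `<=` orth_compl [set v] by move=> /(_ x Sx); apply.
  by apply: closed_span_sub => s /vS sv _ ->.
set M := closed_span S.
have vM := @bop_proj_orth M x; set y := csval _ in vM.
have My : cs_set M y by exact: csval_mem.
suff -> : x = y by [].
apply/eqP; rewrite -subr_eq0; apply/eqP/hdot_eq0.
rewrite hdotBl [X in _ - X]hdotC (vM y My) conjC0 subr0.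
by apply: Sx => s Ss; rewrite hdotC vM ?conjC0//; exact: closed_span_incl.
Qed.

Lemma closed_span_approx (S : set H) x (eps : R[i]) :
  cs_set (closed_span S) x -> 0 < eps -> exists2 z, lin_span S z & `|x - z| < eps.
Proof.
move=> Sx e0; have [z [Sz xz]] := Sx _ (nbhsx_ballx x eps e0).
by exists z => //; move: xz; rewrite -ball_normE.
Qed.

(** Totality as triviality of the orthogonal complement, a test that involves no approximation. *)
Definition total_family (I : Type) (k : I -> H) :=
  forall v, (forall i, '[k i, v] = 0) -> v = 0.

Lemma total_familyP (I : Type) (k : I -> H) :
  total_family k <-> cs_set (closed_span (range k)) = setT.
Proof.
split=> [kT|kT v vk].
  apply/seteqP; split=> // x _; apply/closed_spanP => v vk.
  by rewrite (kT v) ?hdot0r// => i; apply: vk; exists i.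
apply: hdot_eq0; have : cs_set (closed_span (range k)) v by rewrite kT.
by move=> /closed_spanP; apply => _ [i _ <-].
Qed.

End ClosedSubspaces.

Lemma bop_eq_total H K I (k : I -> H) (S T : bop H K) :
  total_family k -> (forall i, S (k i) = T (k i)) -> S = T.
Proof.
move=> kT ST; apply: bopP => x; apply/eqP; rewrite -subr_eq0; apply/eqP/hdot_injl => w.
rewrite hdot0l hdotBl !adjointE -hdotBr (kT (_ - _)) ?hdot0r// => i.
by rewrite hdotBr -!adjointE ST subrr.
Qed.

(** * Gram matrices and the unitaries they determine *)

Section GramMatrix.
Variables (I : Type).

Definition lin_comb H (k : I -> H) (l : seq (R[i] * I)) : H :=
  \sum_(p <- l) p.1 *: k p.2.

Lemma lin_comb_lin H (k : I -> H) (a : R[i]) l m :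
  a *: lin_comb k l + lin_comb k m =
  lin_comb k ([seq (a * p.1, p.2) | p <- l] ++ m).
Proof.
rewrite /lin_comb big_cat/= big_map scaler_sumr; congr (_ + _).
by apply: eq_bigr => p _; rewrite scalerA.
Qed.

Lemma lin_comb_span H (k : I -> H) z :
  lin_span (range k) z -> exists l, z = lin_comb k l.
Proof.
move=> [m [c [s [ks ->]]]].
have /(@boolp.choice 'I_m I)[t kt] j : exists i, k i = s j.
  by have [i _ <-] := ks j; exists i.
exists [seq (c j, t j) | j <- index_enum 'I_m]; rewrite /lin_comb big_map/=.
by apply: eq_bigr => j _; rewrite kt.
Qed.

Lemma lin_comb_gram H K (k : I -> H) (k' : I -> K) l :
  (forall i j, '[k i, k j] = '[k' i, k' j]) ->
  `|lin_comb k l| = `|lin_comb k' l|.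
Proof.
move=> kk'; apply: hnorm_eq_dot; rewrite /lin_comb !hdot_suml.
apply: eq_bigr => p _; rewrite !hdot_sumr; apply: eq_bigr => q _.
by rewrite !hdotZl !hdotZr kk'.
Qed.

(** The closure of the relation between [lin_comb k l] and [lin_comb k' l]: one list of coefficients
    approximates both vectors. If the Gram matrices agree and [k] is total, it is the graph of a
    linear isometry. *)
Let close H K (k : I -> H) (k' : I -> K) x y := forall eps : R[i], 0 < eps ->
  exists2 l, `|x - lin_comb k l| < eps & `|y - lin_comb k' l| < eps.

Let close_norm H K (k : I -> H) (k' : I -> K) x y :
  (forall i j, '[k i, k j] = '[k' i, k' j]) -> close k k' x y -> `|x| = `|y|.
Proof.
move=> kk' xy.
have half H1 K1 (h : I -> H1) (h' : I -> K1) (u : H1) (v : K1) :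
    (forall l, `|lin_comb h l| = `|lin_comb h' l|) ->
    close h h' u v -> `|u| <= `|v|.
  move=> hh uv; apply/ler_addgt0Pr => e e0.
  have [l ul vl] := uv _ (divr_gt0 e0 (ltr0n _ 2)).
  rewrite (splitr e) addrA -[u](subrK (lin_comb h l)) addrC.
  rewrite (le_trans (ler_normD _ _))// lerD ?(ltW ul)// hh.
  rewrite -[lin_comb h' l](subKr v) (le_trans (ler_normB _ _))// lerD2l.
  exact: ltW.
apply/eqP; rewrite eq_le; apply/andP; split; apply: half.
- by move=> l; exact: lin_comb_gram.
- exact: xy.
- by move=> l; apply/esym; exact: lin_comb_gram.
- by move=> e e0; have [l ? ?] := xy e e0; exists l.
Qed.

Let close_lin H K (k : I -> H) (k' : I -> K) (a : R[i]) x y u v :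
  close k k' x y -> close k k' u v -> close k k' (a *: x + u) (a *: y + v).
Proof.
move=> xy uv e e0.
have a1 : 0 < 1 + `|a| by rewrite ltr_pwDl.
have [l xl yl] := xy _ (divr_gt0 (divr_gt0 e0 (ltr0n _ 2)) a1).
have [m um vm] := uv _ (divr_gt0 e0 (ltr0n _ 2)).
have h H1 (w1 w2 z1 z2 : H1) : `|w1 - z1| < e / 2%:R / (1 + `|a|) ->
    `|w2 - z2| < e / 2%:R -> `|a *: w1 + w2 - (a *: z1 + z2)| < e.
  move=> h1 h2; rewrite (splitr e) opprD addrACA -scalerBr.
  rewrite (le_lt_trans (ler_normD _ _))// ler_ltD// normrZ.
  apply: (@le_trans _ _ ((1 + `|a|) * `|w1 - z1|)).
    by rewrite ler_wpM2r// lerDr.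
  by rewrite -ler_pdivlMl// mulrC ltW.
by exists ([seq (a * p.1, p.2) | p <- l] ++ m); rewrite -lin_comb_lin; apply: h.
Qed.

Let close_ex H K (k : I -> H) (k' : I -> K) x :
  (forall i j, '[k i, k j] = '[k' i, k' j]) -> total_family k ->
  exists y, close k k' x y.
Proof.
move=> kk' /total_familyP kT.
pose B (e : R[i]) := [set y | exists2 l, y = lin_comb k' l & `|x - lin_comb k l| < e].
have [||e y z e0 [l -> xl] [m -> xm]|y yB] := @complete_approx K B.
- move=> e e0; have kx : cs_set (closed_span (range k)) x by rewrite kT.
  have [z /lin_comb_span[l ->] xz] := closed_span_approx kx e0.
  by exists (lin_comb k' l); exists l.
- move=> e1 e2 e12 y [l yl xl]; exists l => //.
  exact: lt_le_trans e12.
- rewrite addrC -scaleN1r lin_comb_lin -(lin_comb_gram _ kk') -lin_comb_lin.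
  rewrite scaleN1r addrC -[X in X - _](subrK x) -addrA mulr2n.
  by rewrite (le_trans (ler_normD _ _))// lerD ?(ltW xm)// distrC ltW.
by exists y => e /yB[_ [l -> xl] yl]; exists l.
Qed.

Let close_uniq H K (k : I -> H) (k' : I -> K) x y y' :
  (forall i j, '[k i, k j] = '[k' i, k' j]) ->
  close k k' x y -> close k k' x y' -> y = y'.
Proof.
move=> kk' xy xy'; have := close_norm kk' (close_lin (-1) xy xy').
rewrite !scaleN1r addNr normr0 => /esym/normr0_eq0/eqP.
by rewrite addrC subr_eq0 => /eqP.
Qed.

Lemma gram_unitary H K (k : I -> H) (k' : I -> K) :
  (forall i j, '[k i, k j] = '[k' i, k' j]) ->
  total_family k -> total_family k' ->
  exists2 U : bop H K, unitary U & forall i, U (k i) = k' i.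
Proof.
move=> kk' kT kT'.
have [f fP] := boolp.choice (fun x => close_ex x kk' kT).
have flin : linear f.
  move=> a x y; apply: (close_uniq kk' (fP _)).
  exact: close_lin.
have fiso x : `|f x| = `|x| by rewrite -(close_norm kk' (fP x)).
have f1 x : `|f x| <= 1 * `|x| by rewrite fiso mul1r.
have [U UE] := bop_ext_ex flin ler01 f1.
exists U => [|i]; last first.
  rewrite UE; apply: (close_uniq kk' (fP _)) => e e0; exists [:: (1, i)].
    by rewrite /lin_comb big_seq1 scale1r subrr normr0.
  by rewrite /lin_comb big_seq1 scale1r subrr normr0.
split=> [x y|]; first by rewrite !UE; exact: linear_isometry_dot.
apply/seteqP; split=> // y _.
have k'k i j : '[k' i, k' j] = '[k i, k j] by rewrite kk'.
(* Surjectivity: [close] is symmetric in the two families, so exchanging them yields a preimage. *)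
have [x yx] := close_ex y k'k kT'.
exists x => //; rewrite UE; apply: (close_uniq kk' (fP _)) => e e0.
by have [l ? ?] := yx e e0; exists l.
Qed.

End GramMatrix.

(** Zorn's lemma for orthonormal sets: a nonzero vector orthogonal to a maximal one could be
    normalised and adjoined. *)
Lemma orthonormal_basis_ex H :
  exists (I : choiceType) (e : I -> H), orthonormal_basis e.
Proof.
pose P (S : set H) := forall x y, S x -> S y -> '[x, y] = (x == y)%:R.
have [|S [PS Smax]] := @Zorn_bigcup H P.
  move=> F FP Ftot x y [X FX Xx] [Y FY Yy].
  have [XY|YX] := Ftot _ _ FX FY.
    by apply: (FP _ FY) => //; exact: XY.
  by apply: (FP _ FX) => //; exact: YX.
exists (set_type S), val; split=> [a b|].
  by rewrite PS// -in_setE; exact: valP.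
apply/total_familyP => v vS; apply: contrapT => /eqP v0.
have nv : `|v| != 0 by rewrite normr_eq0.
pose w := `|v|^-1 *: v.
have ww : '[w, w] = 1.
  by rewrite -hnormE normrZ normfV normr_id mulVf// expr1n.
have Sw s : S s -> '[s, w] = 0.
  move=> Ss; rewrite hdotZr; have Ss' : s \in S by rewrite inE.
  by have := vS (SigSub Ss'); rewrite /= => ->; rewrite mulr0.
have nSw s : S s -> s == w = false.
  by move=> Ss; apply/eqP => sw; move: (Sw _ Ss); rewrite sw ww => /eqP; rewrite oner_eq0.
apply: (Smax (S `|` [set w])).
  split; first exact: subsetUl.
  by move=> /(_ w (or_intror erefl)) /nSw; rewrite eqxx.
move=> x y [Sx|->] [Sy|->].
- exact: PS.
- by rewrite Sw// nSw.
- by rewrite hdotC Sw// conjC0 eq_sym nSw.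
- by rewrite ww eqxx.
Qed.

End HilbertSpaces.

(** * Bounded operators: adjoints, unitaries, rank one operators, norm limits *)

Lemma half_pow_small (R : realType) (c eps : R[i]) :
  0 <= c -> 0 < eps -> exists k, c * 2%:R^-1 ^+ k <= eps.
Proof.
move=> c0 e0; have q0 : 0 <= c / eps by rewrite divr_ge0// ltW.
pose n := Num.bound (complex.Re (c / eps)); exists n.
have qn : c / eps <= n%:R.
  rewrite -(RRe_real (ger0_real q0)) -(rmorph_nat (real_complex R)) lecR ltW//.
  by apply: archi_boundP; rewrite -lecR RRe_real// ger0_real.
rewrite exprVn ler_pdivrMr ?exprn_gt0// mulrC -ler_pdivrMr//.
by rewrite (le_trans qn)// -natrX ler_nat ltnW// ltn_expl.
Qed.

Section Operators.
Context {R : realType}.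
Implicit Types H K L : hilbertType R.

Lemma adjointEr H K (T : bop H K) x y : '[x, T y] = '[adjoint T x, y].
Proof. by rewrite hdotC adjointE -hdotC. Qed.

Lemma adjoint_uniq H K (T : bop H K) (S : bop K H) :
  (forall x y, '[T x, y] = '[x, S y]) -> adjoint T = S.
Proof. by move=> TS; apply: bopP => y; apply: hdot_inj => x; rewrite -adjointE. Qed.

Lemma adjointK H K (T : bop H K) : adjoint (adjoint T) = T.
Proof. by apply: adjoint_uniq => x y; rewrite -adjointEr. Qed.

Lemma adjoint_comp H K L (S : bop K L) (T : bop H K) :
  adjoint (bop_comp S T) = bop_comp (adjoint T) (adjoint S).
Proof. by apply: adjoint_uniq => x y; rewrite /= !adjointE. Qed.

Lemma bopZ H K (T : bop H K) (a : R[i]) x : T (a *: x) = a *: T x.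
Proof. exact: linearZ. Qed.

Lemma bop_linE H K (a : R[i]) (S T : bop H K) x :
  bop_lin a S T x = a *: S x + T x.
Proof. by []. Qed.

Lemma unitaryK H K (U : bop H K) : unitary U -> cancel U (adjoint U).
Proof.
by move=> [Uiso _] x; apply: hdot_injl => y; rewrite -adjointEr Uiso.
Qed.

Lemma unitaryVK H K (U : bop H K) : unitary U -> cancel (adjoint U) U.
Proof.
move=> uU y; have [x _ <-] : range U y by rewrite uU.2.
by rewrite unitaryK.
Qed.

Lemma unitary_adjoint H K (U : bop H K) : unitary U -> unitary (adjoint U).
Proof.
move=> uU; split=> [x y|]; first by rewrite -adjointE unitaryVK.
by apply/seteqP; split=> // x _; exists (U x); rewrite ?unitaryK.
Qed.

Lemma cancel_unitary H K (U : bop H K) :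
  cancel U (adjoint U) -> cancel (adjoint U) U -> unitary U.
Proof.
move=> UK UVK; split=> [x y|]; first by rewrite adjointE UK.
by apply/seteqP; split=> // y _; exists (adjoint U y).
Qed.

Lemma bop_rank1_ex H K (u : K) (v : H) :
  exists T : bop H K, forall x, T x = '[x, v] *: u.
Proof.
apply: (@bop_ext_ex _ _ _ (fun x => '[x, v] *: u) (`|v| * `|u|)) => [a x y||x].
- by rewrite hdotDl hdotZl scalerDl scalerA.
- exact: mulr_ge0.
- by rewrite normrZ mulrAC ler_wpM2r// mulrC hCauchySchwarz.
Qed.

Definition bop_rank1 H K (u : K) (v : H) : bop H K :=
  projT1 (cid (bop_rank1_ex u v)).

Lemma bop_rank1E H K (u : K) (v : H) x : bop_rank1 u v x = '[x, v] *: u.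
Proof. exact: (projT2 (cid (bop_rank1_ex u v)) x). Qed.

Lemma adjoint_rank1 H K (u : K) (v : H) :
  adjoint (bop_rank1 u v) = bop_rank1 v u.
Proof.
apply: adjoint_uniq => x y; rewrite !bop_rank1E hdotZl hdotZr mulrC.
by rewrite -hdotC mulrC.
Qed.

Lemma comp_rank1 H K L (T : bop K L) (u : K) (v : H) :
  bop_comp T (bop_rank1 u v) = bop_rank1 (T u) v.
Proof. by apply: bopP => x; rewrite /= !bop_rank1E linearZ. Qed.

Lemma opnorm_rank1 H K (u : K) (v : H) :
  opnorm_le (bop_rank1 u v) (`|u| * `|v|).
Proof.
move=> x; rewrite bop_rank1E normrZ mulrC -mulrA ler_wpM2l// mulrC.
exact: hCauchySchwarz.
Qed.

Lemma opnorm_comp H K L (S : bop K L) (T : bop H K) c d :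
  0 <= c -> opnorm_le S c -> opnorm_le T d -> opnorm_le (bop_comp S T) (c * d).
Proof.
move=> c0 Sc Td x; rewrite (le_trans (Sc _))// -mulrA ler_wpM2l//.
Qed.

Lemma opnorm_adjoint H K (T : bop H K) c :
  0 <= c -> opnorm_le T c -> opnorm_le (adjoint T) c.
Proof.
move=> c0 Tc y; set z := adjoint T y.
have [->|z0] := eqVneq z 0; first by rewrite normr0 mulr_ge0.
have z_gt0 : 0 < `|z| by rewrite normr_gt0.
rewrite -(ler_pM2r z_gt0) -expr2 hnormE {2}/z -adjointE.
rewrite (le_trans (real_ler_norm _))//.
  by rewrite adjointE -hnormE rpredX ?normr_real.
by rewrite (le_trans (hCauchySchwarz _ _))// mulrAC ler_wpM2r.
Qed.

(** The tails of the geometric series of steps give pointwise limits at the stated rate; these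
    limits form a bounded linear map. *)
Lemma bop_dyadic_limit H K (Y : nat -> bop H K) :
  (forall k, opnorm_le (bop_lin (-1) (Y k) (Y k.+1)) (2%:R^-1 ^+ k)) ->
  exists Z, forall k,
    opnorm_le (bop_lin (-1) (Y k) Z) (2%:R * 2%:R^-1 ^+ k).
Proof.
move=> Ystep; pose h : R[i] := 2%:R^-1.
have h0 k : 0 <= h ^+ k by rewrite exprn_ge0// invr_ge0.
(* The exact geometric sum of [j] steps; the cruder bound [2 * h ^ k] would not pass through the
   induction. *)
have Ydist j k x : `|Y (k + j)%N x - Y k x| <= 2%:R * (h ^+ k - h ^+ (k + j)) * `|x|.
  elim: j => [|j IH]; first by rewrite addn0 !subrr normr0 mulr0 mul0r.
  have Yj := Ystep (k + j)%N x; rewrite /= scaleN1r addrC in Yj.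
  rewrite addnS -[Y _.+1 x](subrK (Y (k + j)%N x)) -addrA.
  rewrite (le_trans (ler_normD _ _))// (le_trans (lerD Yj IH))//.
  rewrite -mulrDl ler_wpM2r// exprS -/h le_eqVlt; apply/orP; left; apply/eqP.
  by move: (h ^+ k) (h ^+ (k + j)) => t s; rewrite /h; field.
have Yd j k x : (k <= j)%N -> `|Y j x - Y k x| <= 2%:R * h ^+ k * `|x|.
  move=> kj; rewrite -(subnKC kj) (le_trans (Ydist _ _ _))// ler_wpM2r//.
  by rewrite ler_wpM2l// lerBlDr lerDl.
have Yl x : exists z, forall k, `|z - Y k x| <= 2%:R * h ^+ k * `|x|.
  pose B (e : R[i]) := [set z | exists2 k, 2%:R * h ^+ k * `|x| <= e & z = Y k x].
  have [||e y z e0 [j je ->] [k ke ->]|z zB] := @complete_approx _ K B.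
  - move=> e e0; have c0 : 0 <= 2%:R * `|x| by rewrite mulr_ge0.
    by have [k ke] := half_pow_small c0 e0; exists (Y k x), k => //; rewrite mulrAC.
  - by move=> e1 e2 e12 _ [k ke ->]; exists k => //; exact: le_trans e12.
  - apply: (@le_trans _ _ e); last by rewrite mulr2n lerDl ltW.
    have [jk|/ltnW kj] := leqP j k.
      by rewrite distrC (le_trans (Yd _ _ _ jk)).
    by rewrite (le_trans (Yd _ _ _ kj)).
  exists z => k; apply/ler_addgt0Pr => e e0.
  have [_ [j je ->] zj] := zB _ (divr_gt0 e0 (ltr0n _ 2)).
  rewrite [e]splitr -[z](subrK (Y j x)) -addrA (le_trans (ler_normD _ _))//.
  rewrite addrCA lerD//; first exact: ltW.
  have [jk|/ltnW kj] := leqP j k.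
    rewrite distrC (le_trans (Yd _ _ _ jk))// (le_trans je)// lerDr.
    by rewrite !mulr_ge0.
  by rewrite (le_trans (Yd _ _ _ kj))// lerDl ltW// divr_gt0.
have [f fP] := boolp.choice Yl.
have f_uniq x z (c : R[i]) :
    0 <= c -> (forall k, `|z - Y k x| <= c * h ^+ k) -> f x = z.
  move=> c0 zP; apply/eqP; rewrite -subr_eq0 -normr_le0; apply/ler_addgt0Pr => e e0.
  have c1 : 0 <= 2%:R * `|x| + c by rewrite addr_ge0// mulr_ge0.
  have [k ke] := half_pow_small c1 e0.
  rewrite add0r (le_trans _ ke)// -[f x](subrK (Y k x)) -addrA.
  rewrite (le_trans (ler_normD _ _))// mulrDl lerD//.
    by rewrite mulrAC; exact: fP.
  by rewrite distrC; exact: zP.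
have flin : linear f.
  move=> a x y.
  apply: (@f_uniq _ _ (`|a| * (2%:R * `|x|) + 2%:R * `|y|)) => [|k].
    by rewrite addr_ge0 ?mulr_ge0.
  rewrite linearP opprD addrACA -scalerBr (le_trans (ler_normD _ _))//.
  rewrite normrZ mulrDl lerD//; last by rewrite mulrAC.
  by rewrite -mulrA ler_wpM2l// mulrAC.
have [c c0 Y0c] := bop_bounded (Y 0%N).
have fb x : `|f x| <= (2%:R + c) * `|x|.
  rewrite -[f x](subrK (Y 0%N x)) (le_trans (ler_normD _ _))// mulrDl lerD//.
  by have := fP x 0%N; rewrite expr0 mulr1.
have [|Z ZE] := bop_ext_ex flin _ fb; first by rewrite addr_ge0.
by exists Z => k x; rewrite /= scaleN1r addrC ZE.
Qed.

Definition bop_zero H : bop H H := bop_lin (-1) (bop_id H) (bop_id H).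

Lemma bop_zeroE H x : bop_zero H x = 0.
Proof. by rewrite /= scaleN1r addNr. Qed.

Definition bop_sum H I (s : seq I) (X : I -> bop H H) : bop H H :=
  foldr (fun i => bop_lin 1 (X i)) (bop_zero H) s.

Lemma bop_sumE H I (s : seq I) (X : I -> bop H H) x :
  bop_sum s X x = \sum_(i <- s) X i x.
Proof.
elim: s => [|i s IH]; first by rewrite big_nil bop_zeroE.
by rewrite big_cons -IH /= scale1r.
Qed.

End Operators.

(** * C*-algebras of operators and the boundedness of their representations *)

Section StarAlgebras.
Context {R : realType} {H : hilbertType R} (A : set (bop H H)).
Hypothesis A_alg : cstar_subalgebra A.

Lemma cstar_id : A (bop_id H). Proof. by case: A_alg. Qed.

Lemma cstar_lin a X Y : A X -> A Y -> A (bop_lin a X Y).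
Proof. by case: A_alg => _ h _ _ _; exact: h. Qed.

Lemma cstar_comp X Y : A X -> A Y -> A (bop_comp X Y).
Proof. by case: A_alg => _ _ h _ _; exact: h. Qed.

Lemma cstar_adjoint X : A X -> A (adjoint X).
Proof. by case: A_alg => _ _ _ h _; exact: h. Qed.

Lemma cstar_lim X : (forall eps : R[i], 0 < eps ->
  exists2 Y, A Y & opnorm_le (bop_lin (- 1) Y X) eps) -> A X.
Proof. by case: A_alg => _ _ _ _ h; exact: h. Qed.

Lemma cstar_zero : A (bop_zero H).
Proof. by apply: cstar_lin; exact: cstar_id. Qed.

Lemma cstar_sum I (s : seq I) (X : I -> bop H H) :
  (forall i, A (X i)) -> A (bop_sum s X).
Proof.
by move=> AX; elim: s => [|i s IH]; [exact: cstar_zero | exact: cstar_lin].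
Qed.

(* [Y] solves [Y = (X^* X + Y^2) / 2], so that [(1 - Y)^2 = 1 - X^* X]; it is the
   limit of the fixed point iteration, a contraction on the ball of radius 1/2. *)
Lemma cstar_sqrt X : A X -> opnorm_le X 2%:R^-1 ->
  exists Y, [/\ A Y, adjoint Y = Y &
    forall x, adjoint X (X x) = 2%:R *: Y x - Y (Y x)].
Proof.
move=> AX Xh; pose h : R[i] := 2%:R^-1.
have h0 : 0 <= h by rewrite invr_ge0.
pose Q := bop_comp (adjoint X) X.
have AQ : A Q by apply: cstar_comp => //; exact: cstar_adjoint.
have Qh : opnorm_le Q (h * h) by apply: opnorm_comp => //; exact: opnorm_adjoint.
pose F Y := bop_lin h (bop_lin 1 (bop_comp Y Y) Q) (bop_zero H).
have FE Y x : F Y x = h *: (Y (Y x) + Q x).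
  by rewrite -[RHS]addr0 -(bop_zeroE x) /= scale1r.
have normB c (S T : bop H H) x : opnorm_le (bop_lin (-1) S T) c ->
    `|T x - S x| <= c * `|x|.
  by move=> /(_ x); rewrite /= scaleN1r addrC.
pose Y k := iter k F (bop_zero H).
have YS k x : Y k.+1 x = h *: (Y k (Y k x) + Q x) by rewrite -FE.
have AY k : A (Y k).
  elim: k => [|k IH]; first exact: cstar_zero.
  rewrite /Y iterS; apply: cstar_lin; last exact: cstar_zero.
  by apply: cstar_lin => //; exact: cstar_comp.
have Yh k : opnorm_le (Y k) h.
  elim: k => [|k IH] x; first by rewrite bop_zeroE normr0 mulr_ge0.
  rewrite /Y iterS FE normrZ (ger0_norm h0) ler_wpM2l//.
  rewrite (le_trans (ler_normD _ _))//.
  have := lerD (opnorm_comp h0 IH IH x) (Qh x).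
  move=> /le_trans; apply; rewrite -mulrDl ler_piMl//.
  by rewrite (_ : h * h + h * h = h) ?invf_le1 ?ler1n// /h; field.
have Yadj k : adjoint (Y k) = Y k.
  elim: k => [|k IH]; apply: adjoint_uniq => x y.
    by rewrite !bop_zeroE hdot0l hdot0r.
  rewrite /Y iterS !FE hdotZl hdotZr fmorphV rmorph_nat; congr (_ * _).
  rewrite hdotDl hdotDr; congr (_ + _); last by rewrite /= !adjointE adjointK.
  by rewrite -/(Y k) adjointE IH adjointE IH.
(* [T T - S S = (T - S) T + S (T - S)], estimated term by term. *)
have YB (S T : bop H H) c x : 0 <= c -> opnorm_le S c ->
    `|T (T x) - S (S x)| <= `|T (T x) - S (T x)| + c * `|T x - S x|.
  move=> c0 Sc; rewrite -[T (T x)](subrK (S (T x))) -addrA.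
  by rewrite (le_trans (ler_normD _ _))// addrK lerD2l -linearB.
(* The iterates have norm at most [h], so each of the two terms gains a factor [h]; with the outer
   factor [h] the step is halved. *)
have Ystep k : opnorm_le (bop_lin (-1) (Y k) (Y k.+1)) (h ^+ k).
  elim: k => [|k IH] x; rewrite bop_linE scaleN1r addrC.
    rewrite bop_zeroE subr0 expr0 mul1r.
    apply: le_trans (Yh 1%N x) _; rewrite ler_piMl//.
    by rewrite invf_le1// ler1n.
  rewrite (YS k.+1) [X in _ - X](YS k) -scalerBr opprD addrACA subrr addr0.
  rewrite normrZ (ger0_norm h0) exprS -mulrA ler_wpM2l//.
  rewrite (le_trans (YB _ _ _ _ h0 (Yh k)))//.
  rewrite (le_trans (lerD (normB _ _ _ _ IH) (ler_wpM2l h0 (normB _ _ _ _ IH))))//.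
  apply: (@le_trans _ _ (h ^+ k * (h * `|x|) + h * (h ^+ k * `|x|))).
    by rewrite lerD2r ler_wpM2l ?exprn_ge0// Yh.
  by rewrite le_eqVlt; apply/orP; left; apply/eqP; rewrite /h; field.
have [Z ZY] := bop_dyadic_limit Ystep.
have ZY' k x := normB _ _ _ x (ZY k).
have [c c0 Zc] := bop_bounded Z.
have small (r d : R[i]) : 0 <= d -> (forall k, r <= d * h ^+ k) -> r <= 0.
  move=> d0 rd; apply/ler_addgt0Pr => e e0; rewrite add0r.
  by have [k ke] := half_pow_small d0 e0; exact: le_trans ke.
(* Passage to the limit in the recursion for [Y]: every error is a constant multiple of [h ^ k]. *)
have ZE x : Z x = F Z x.
  apply/eqP; rewrite -subr_eq0 -normr_le0.
  apply: (@small _ ((2%:R + c * 2%:R + 2%:R) * `|x|)) => [|k].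
    by rewrite mulr_ge0// !addr_ge0// mulr_ge0.
  have hk : 0 <= h ^+ k by rewrite exprn_ge0.
  rewrite -[Z x](subrK (Y k.+1 x)) -addrA (le_trans (ler_normD _ _))//.
  rewrite (le_trans (lerD (ZY' k.+1 x) (lexx _)))//.
  rewrite YS FE -scalerBr opprD addrACA subrr addr0 normrZ (ger0_norm h0) distrC.
  have zz := YB (Y k) Z h x h0 (Yh k).
  have z1 := le_trans (ZY' k (Z x)) (ler_wpM2l (mulr_ge0 (ler0n _ 2) hk) (Zc x)).
  have z2 := ler_wpM2l h0 (ZY' k x).
  have zs := ler_wpM2l h0 (le_trans zz (lerD z1 z2)).
  rewrite (le_trans (lerD (lexx _) zs))// exprS -/h.
  rewrite -subr_ge0 (_ : _ - _ = (5%:R * h + c) * h ^+ k * `|x|); last first.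
    by move: (h ^+ k) => t; rewrite /h; field.
  by rewrite !mulr_ge0// addr_ge0// mulr_ge0.
exists Z; split.
- apply: cstar_lim => e e0.
  have [k ke] := half_pow_small (ler0n _ 2) e0; exists (Y k) => // x.
  by rewrite (le_trans (ZY k x))// ler_wpM2r.
- apply: adjoint_uniq => x y; apply/eqP; rewrite -subr_eq0 -normr_le0.
  apply: (@small _ (4%:R * (`|x| * `|y|))) => [|k].
    by rewrite !mulr_ge0.
  rewrite (_ : _ - _ = '[Z x - Y k x, y] - '[x, Z y - Y k y]); last first.
    by rewrite hdotBl hdotBr (adjointE (Y k)) Yadj; ring.
  rewrite (le_trans (ler_normB _ _))//.
  have z1 := le_trans (hCauchySchwarz _ _) (ler_wpM2r (normr_ge0 y) (ZY' k x)).
  have z2 := le_trans (hCauchySchwarz _ _) (ler_wpM2l (normr_ge0 x) (ZY' k y)).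
  rewrite (le_trans (lerD z1 z2))// le_eqVlt; apply/orP; left; apply/eqP.
  by rewrite -/h; ring.
- by move=> x; rewrite {1}ZE FE scalerA mulfV// scale1r [_ + Q x]addrC addrK.
Qed.

Section Representations.
Context {K : hilbertType R} (pi : bop H H -> bop K K).
Hypothesis pi_rep : unital_star_rep A pi.

Lemma rep_id x : pi (bop_id H) x = x.
Proof. by case: pi_rep => -> _ _ _. Qed.

Lemma rep_lin a X Y x : A X -> A Y ->
  pi (bop_lin a X Y) x = a *: pi X x + pi Y x.
Proof. by case: pi_rep => _ h _ _ AX AY; rewrite h. Qed.

Lemma rep_comp X Y x : A X -> A Y -> pi (bop_comp X Y) x = pi X (pi Y x).
Proof. by case: pi_rep => _ _ h _ AX AY; rewrite h. Qed.

Lemma rep_adjoint X : A X -> pi (adjoint X) = adjoint (pi X).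
Proof. by case: pi_rep => _ _ _; apply. Qed.

Lemma rep_zero x : pi (bop_zero H) x = 0.
Proof. by rewrite rep_lin ?rep_id ?scaleN1r ?addNr//; exact: cstar_id. Qed.

Lemma rep_sum I (s : seq I) (X : I -> bop H H) x : (forall i, A (X i)) ->
  pi (bop_sum s X) x = \sum_(i <- s) pi (X i) x.
Proof.
move=> AX; elim: s => [|i s IH]; first by rewrite big_nil rep_zero.
by rewrite big_cons -IH /= rep_lin ?scale1r//; exact: cstar_sum.
Qed.

(** After scaling by [2 * c], the origin of the factor 2, [1 - X'^* X'] is the square of the
    self-adjoint [1 - Y]. The relation survives under [pi], so [|x|^2 - |pi X' x|^2 = |x - pi Y x|^2
    >= 0]. *)
Lemma rep_bounded X c : A X -> 0 < c -> opnorm_le X c ->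
  opnorm_le (pi X) (2%:R * c).
Proof.
move=> AX c0 Xc; pose X' := bop_lin (2%:R * c)^-1 X (bop_zero H).
have c2 : 0 < 2%:R * c by rewrite mulr_gt0.
have AX' : A X' by apply: cstar_lin => //; exact: cstar_zero.
have X'h : opnorm_le X' 2%:R^-1.
  move=> x; rewrite /X' /bop_lin/= scaleN1r addNr addr0 normrZ normfV.
  rewrite (ger0_norm (ltW c2)) ler_pdivrMl// [leRHS](_ : _ = c * `|x|); last by field.
  exact: Xc.
have [Y [AY Yadj YE]] := cstar_sqrt AX' X'h.
have piY : adjoint (pi Y) = pi Y by rewrite -rep_adjoint// Yadj.
have piX' x : `|pi X' x| <= `|x|.
  rewrite -[leRHS]mul1r; apply: hnorm_le_dot => //.
  rewrite expr1n mul1r adjointEr -rep_adjoint// -rep_comp//; last exact: cstar_adjoint.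
  have -> : bop_comp (adjoint X') X' =
      bop_lin 2%:R Y (bop_lin (-1) (bop_comp Y Y) (bop_zero H)).
    apply: bopP => y; rewrite [LHS]YE; congr (_ + _).
    by rewrite -[LHS]addr0 -(bop_zeroE y) -scaleN1r.
  have AYY : A (bop_comp Y Y) by exact: cstar_comp.
  have AYY0 := cstar_lin (-1) AYY cstar_zero.
  rewrite (rep_lin _ _ AY AYY0) (rep_lin _ _ AYY cstar_zero).
  rewrite rep_zero rep_comp// addr0 scaleN1r -subr_ge0.
  have := dnorm_ge0 (hdot K) (x - pi Y x).
  have yx : '[x, pi Y x] = '[pi Y x, x] by rewrite adjointEr piY.
  rewrite !hdotBl !hdotBr yx hdotZl (adjointE (pi Y) (pi Y x)) piY.
  by congr (0 <= _); ring.
move=> x; have -> : pi X x = (2%:R * c) *: pi X' x.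
  rewrite (rep_lin _ _ AX cstar_zero) rep_zero addr0 scalerA mulfV ?scale1r//.
  by rewrite gt_eqF.
by rewrite normrZ (ger0_norm (ltW c2)) ler_wpM2l// ltW.
Qed.

End Representations.

End StarAlgebras.

(** * Compactness of rank one operators *)

Section CompactOperators.
Context {R : realType}.
Implicit Types H K : hilbertType R.

Lemma norm_real_complex (x : R) : `|x%:C| = `|x|%:C :> R[i].
Proof. by rewrite normc_def/= expr0n/= addr0 sqrtr_sqr. Qed.

Lemma complex_scale_continuous H (u : H) :
  continuous (fun p : R * R => (p.1 +i* p.2)%C *: u).
Proof.
move=> p; apply/cvgrPdist_lt => e e0.
have u1 : 0 < 1 + `|u| by rewrite ltr_pwDl.
have d0 : 0 < e / 2%:R / (1 + `|u|) by rewrite !divr_gt0.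
have r0 : 0 < complex.Re (e / 2%:R / (1 + `|u|)).
  by move: d0; rewrite ltcE => /andP[].
have rE : (complex.Re (e / 2%:R / (1 + `|u|)))%:C = e / 2%:R / (1 + `|u|).
  by rewrite RRe_real// gtr0_real.
set r := complex.Re _ in r0 rE.
exists (ball p.1 r, ball p.2 r) => /=.
  by split; exact: nbhsx_ballx.
move=> q /= [q1 q2]; rewrite -scalerBl normrZ.
have -> : (p.1 +i* p.2 - (q.1 +i* q.2))%C = (p.1 - q.1)%:C + 'i%C * (p.2 - q.2)%:C.
  by simpc.
move: q1 q2; rewrite -!ball_normE/= => q1 q2.
apply: (@le_lt_trans _ _ (`|(p.1 - q.1)%:C + 'i%C * (p.2 - q.2)%:C| * (1 + `|u|))).
  by rewrite ler_wpM2l// lerDr.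
rewrite -ltr_pdivlMr// (le_lt_trans (ler_normD _ _))// normrM.
have -> : `|'i%C : R[i]| = 1 by rewrite normc_def/= expr0n/= expr1n add0r sqrtr1.
rewrite mul1r !norm_real_complex.
have -> : e / (1 + `|u|) = (r + r)%:C.
  by rewrite rmorphD/= rE -mulr2n -mulrnAl -mulr_natr mulfVK.
by rewrite -rmorphD ltcR ltrD.
Qed.

(** The unit ball is sent to multiples of [u] by scalars of modulus at most [|v|], which lie in the
    continuous image of a compact square of the real plane. *)
Lemma compact_op_rank1 H K (u : K) (v : H) : compact_op (bop_rank1 u v).
Proof.
pose r := complex.Re `|v|.
have rE : r%:C = `|v| by rewrite RRe_real// normr_real.
pose D : set (R * R) := `[- r, r] `*` `[- r, r].
apply: (@precompact_subset _ _ ((fun p : R * R => (p.1 +i* p.2)%C *: u) @` D)).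
  move=> _ [x /= x1 <-]; rewrite bop_rank1E.
  have vr : `|'[x, v]| <= r%:C.
    by rewrite rE (le_trans (hCauchySchwarz _ _))// ler_piMl.
  have Re_le (z : R[i]) : `|z| <= r%:C ->
      `|complex.Re z| <= r /\ `|complex.Im z| <= r.
    rewrite normc_def lecR => zr; have z2 : 0 <= r by rewrite (le_trans _ zr)// sqrtr_ge0.
    split; rewrite (le_trans _ zr)// -sqrtr_sqr ler_wsqrtr// ?lerDl ?lerDr sqr_ge0//.
  have [re im] := Re_le _ vr.
  exists (complex.Re '[x, v], complex.Im '[x, v]); last by case: '[x, v].
  by split; rewrite /= in_itv/= -ler_norml.
apply: compact_precompact; first exact: norm_hausdorff.
apply: continuous_compact; last by apply: compact_setX; exact: segment_compact.
by apply: continuous_subspaceT; exact: complex_scale_continuous.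
Qed.

End CompactOperators.

(** * Orthonormal bases and diagonal operators *)

Section DiagonalOperators.
Context {R : realType} {H : hilbertType R} {I : eqType} (e : I -> H).
Hypothesis e_basis : orthonormal_basis e.

Lemma basis_dot a b : '[e a, e b] = (a == b)%:R.
Proof. exact: e_basis.1. Qed.

Lemma basis_total : total_family e.
Proof. by apply/total_familyP; exact: e_basis.2. Qed.

Lemma basis_eq x y : (forall a, '[e a, x] = '[e a, y]) -> x = y.
Proof.
move=> xy; apply/eqP; rewrite -subr_eq0; apply/eqP/basis_total => a.
by rewrite hdotBr xy subrr.
Qed.

Lemma basis_expansion z : lin_span (range e) z ->
  exists2 s, uniq s & z = \sum_(a <- s) '[z, e a] *: e a.
Proof.
move=> /lin_comb_span[l ->]; exists (undup [seq p.2 | p <- l]).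
  exact: undup_uniq.
rewrite {1}/lin_comb; under [RHS]eq_bigr do rewrite hdot_suml scaler_suml.
rewrite exchange_big/= big_seq [RHS]big_seq; apply: eq_bigr => p pl.
have ps : p.2 \in undup [seq p.2 | p <- l] by rewrite mem_undup map_f.
rewrite (bigD1_seq _ ps (undup_uniq _))/= hdotZl basis_dot eqxx mulr1.
rewrite big1 ?addr0// => a /negPf pa.
by rewrite hdotZl basis_dot eq_sym pa mulr0 scale0r.
Qed.

Lemma basis_pythagoras s (c : I -> R[i]) : uniq s ->
  '[\sum_(a <- s) c a *: e a, \sum_(a <- s) c a *: e a] =
  \sum_(a <- s) `|c a| ^+ 2.
Proof.
move=> us; rewrite hdot_suml big_seq [RHS]big_seq; apply: eq_bigr => a sa.
rewrite hdot_sumr (bigD1_seq a)//= big1 => [|b /negPf ba].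
  by rewrite hdotZl hdotZr basis_dot eqxx mulr1 addr0 normCK.
by rewrite hdotZl hdotZr basis_dot eq_sym ba !mulr0.
Qed.

Definition diagonal_op (T : bop H H) (t : I -> R[i]) :=
  forall a, T (e a) = t a *: e a.

(** On finite combinations the bound follows from Pythagoras; it extends to all vectors because [T]
    is already known to be continuous. *)
Lemma opnorm_diagonal T t (M : R[i]) :
  diagonal_op T t -> 0 <= M -> (forall a, `|t a| <= M) -> opnorm_le T M.
Proof.
move=> Tt M0 tM x.
have TzM z : lin_span (range e) z -> `|T z| <= M * `|z|.
  move=> /basis_expansion[s us ->]; set c := fun a => '[z, e a].
  have -> : T (\sum_(a <- s) c a *: e a) = \sum_(a <- s) (c a * t a) *: e a.
    by rewrite linear_sum; apply: eq_bigr => a _; rewrite linearZ/= Tt scalerA.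
  apply: hnorm_le_dot => //; rewrite !basis_pythagoras// mulr_sumr.
  apply: ler_sum => a _; rewrite normrM exprMn mulrC ler_wpM2r ?exprn_ge0//.
  by rewrite ler_pXn2r ?nnegrE.
have [c c0 Tc] := bop_bounded T; apply/ler_addgt0Pr => eps eps0.
(* The error enters as [c * |x - z|] through [T] and as [M * |x - z|] through [|z|]; the summand 1
   keeps the divisor positive. *)
have k0 : 0 < c + M + 1 by rewrite ltr_wpDl// addr_ge0.
have ex : cs_set (closed_span (range e)) x by rewrite e_basis.2.
have [z ez xz] := closed_span_approx ex (divr_gt0 eps0 k0).
rewrite -[T x](subrK (T z)) -linearB (le_trans (ler_normD _ _))//.
rewrite (le_trans (lerD (Tc _) (TzM _ ez)))//.
have zx : `|z| <= `|x| + `|x - z|.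
  by rewrite -[z in leLHS](subKr x) (le_trans (ler_normB _ _)).
rewrite (le_trans (lerD (lexx _) (ler_wpM2l M0 zx)))//.
rewrite mulrDr addrCA lerD2l -mulrDl.
apply: (@le_trans _ _ ((c + M + 1) * `|x - z|)).
  by rewrite ler_wpM2r// lerDl.
by rewrite -ler_pdivlMl// mulrC ltW.
Qed.

Lemma diagonal_lin a S s T t : diagonal_op S s -> diagonal_op T t ->
  diagonal_op (bop_lin a S T) (fun i => a * s i + t i).
Proof. by move=> Ss Tt i; rewrite bop_linE Ss Tt scalerA scalerDl. Qed.

Lemma diagonal_comp S s T t : diagonal_op S s -> diagonal_op T t ->
  diagonal_op (bop_comp S T) (fun i => s i * t i).
Proof. by move=> Ss Tt i; rewrite /= Tt linearZ/= Ss scalerA mulrC. Qed.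

Lemma diagonal_rank1 b : diagonal_op (bop_rank1 (e b) (e b)) (fun a => (a == b)%:R).
Proof.
by move=> a; rewrite bop_rank1E basis_dot; have [->|_] := eqVneq a b; rewrite ?scale0r.
Qed.

End DiagonalOperators.

(** * Words, truncations and the approximation of compact operators *)

Section Words.
Variable (n : nat).

Fixpoint words_below N : seq (seq 'I_n) :=
  if N is N'.+1 then [::] :: [seq i :: w | i <- enum 'I_n, w <- words_below N']
  else [::].

Lemma mem_words_below N w : (w \in words_below N) = (size w < N)%N.
Proof.
elim: N w => [|N IH] [|i w]//=; rewrite inE/= ltnS -IH.
apply/allpairsP/idP => [[[j v] /= [_ vN [_ ->]]]|wN]//.
by exists (i, w); split; rewrite ?mem_enum.
Qed.

Lemma words_below_uniq N : uniq (words_below N).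
Proof.
elim: N => //= N IH; apply/andP; split.
  by apply/allpairsP => -[[i w] [_ _]].
by apply: allpairs_uniq => //; [exact: enum_uniq|move=> [i w] [j v] _ _ [-> ->]].
Qed.

End Words.

Section Truncation.
Context {R : realType} {n : nat} {H : hilbertType R} (e : seq 'I_n -> H).
Hypothesis e_basis : orthonormal_basis e.

(** The projection onto the span of the [e a] with [size a < N], as a finite sum of rank one
    operators, to which algebra membership and representations apply termwise. *)
Definition truncation N : bop H H :=
  bop_sum (words_below n N) (fun a => bop_rank1 (e a) (e a)).

Lemma diagonal_truncation N : diagonal_op e (truncation N) (fun a => (size a < N)%N%:R).
Proof.
move=> a; rewrite bop_sumE; have [aN|aN] := boolP (size a < N)%N.
  rewrite (bigD1_seq a) ?words_below_uniq ?mem_words_below//= big1 => [|b /negPf ba].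
    by rewrite diagonal_rank1// eqxx addr0.
  by rewrite diagonal_rank1// eq_sym ba scale0r.
rewrite scale0r big_seq big1// => b; rewrite mem_words_below => bN.
rewrite diagonal_rank1//; case: eqVneq => [ab|_]; last by rewrite scale0r.
by move: aN; rewrite ab bN.
Qed.

Lemma opnorm_sub_truncation N :
  opnorm_le (bop_lin (-1) (truncation N) (bop_id H)) 1.
Proof.
apply: (@opnorm_diagonal _ _ _ _ e_basis _ (fun a => -1 * (size a < N)%N%:R + 1)) => //.
  by move=> a; rewrite bop_linE diagonal_truncation scalerA scalerDl scale1r.
by move=> a; case: (_ < _)%N; rewrite ?mulr1 ?addNr ?normr0// mulr0 add0r normr1.
Qed.

(** A late truncation fixes a given finite combination near [x], and the complementary projection
    does not increase the remaining error. *)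
Lemma truncation_cvg x (eps : R[i]) : 0 < eps ->
  exists N, forall M, (N <= M)%N -> `|x - truncation M x| <= eps.
Proof.
move=> eps0; have ex : cs_set (closed_span (range e)) x by rewrite e_basis.2.
have [z /lin_comb_span[l ->] xl] := closed_span_approx ex eps0.
exists (\max_(p <- l) (size p.2).+1) => M NM; set z0 := lin_comb e l in xl *.
have Tz : truncation M z0 = z0.
  rewrite /z0 /lin_comb linear_sum big_seq [RHS]big_seq; apply: eq_bigr => p pl.
  rewrite linearZ/= diagonal_truncation (leq_trans _ NM) ?scale1r//.
  exact: (@leq_bigmax_seq _ l xpredT (fun p => (size p.2).+1)).
have := opnorm_sub_truncation M (x - z0).
rewrite bop_linE scaleN1r mul1r linearB/= Tz opprB addrC addrA subrK.
by move=> /le_trans; apply; exact: ltW.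
Qed.

(* The truncations converge strongly to the identity and are uniformly bounded, so
   that the convergence is uniform on the relatively compact image of the ball. *)
Lemma compact_op_approx K (X : bop K H) (eps : R[i]) : compact_op X -> 0 < eps ->
  exists N, opnorm_le (bop_lin (-1) (bop_comp (truncation N) X) X) eps.
Proof.
move=> /=; rewrite /compact_op precompactE => /compact_near_coveringP Xc eps0.
have e2 : 0 < eps / 2%:R by rewrite divr_gt0.
have [|N _ NX] := Xc nat \oo (fun N y => `|y - truncation N y| <= eps).
  move=> y _; have [N yN] := truncation_cvg y e2.
  exists (ball y (eps / 2%:R), [set M | (N <= M)%N]) => /=.
    by split; [exact: nbhsx_ballx|exists N].
  move=> [y' M] /= [+ NM]; rewrite -ball_normE/= distrC => yy'.
  have := opnorm_sub_truncation M (y' - y).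
  rewrite bop_linE scaleN1r mul1r linearB/= => h.
  rewrite [eps]splitr.
  (* Two errors of at most [eps / 2]: the complementary projection applied to [y' - y], and the
     truncation error at the centre [y]. *)
  rewrite (_ : y' - _ = (- (truncation M y' - truncation M y) + (y' - y)) + (y - truncation M y)).
    by rewrite (le_trans (ler_normD _ _))// lerD ?yN// (le_trans h)// ltW.
  by rewrite opprB -addrA subrKA addrC subrKA.
exists N => x; rewrite bop_linE scaleN1r addrC /=.
have [->|x0] := eqVneq x 0; first by rewrite !linear0 addr0 !normr0 mulr0.
have nx : 0 < `|x| by rewrite normr_gt0.
have [u u1 xE] : exists2 u, `|u| = 1 & x = `|x| *: u.
  exists (`|x|^-1 *: x); first by rewrite normrZ normfV normr_id mulVf// gt_eqF.
  by rewrite scalerA mulfV ?gt_eqF// scale1r.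
have -> : X x = `|x| *: X u by rewrite -bopZ -xE.
rewrite bopZ -scalerBr normrZ normr_id mulrC ler_wpM2r//; apply: (NX N) => //=.
by apply: subset_closure; exists u => //=; rewrite u1.
Qed.

End Truncation.

Lemma cstar_gen_subalgebra (R : realType) (H : hilbertType R) (S : set (bop H H)) :
  cstar_subalgebra (cstar_gen S).
Proof.
split.
- by move=> A [Aalg _]; exact: cstar_id.
- by move=> a X Y AX AY A AS; apply: (cstar_lin AS.1); [exact: AX|exact: AY].
- by move=> X Y AX AY A AS; apply: (cstar_comp AS.1); [exact: AX|exact: AY].
- by move=> X AX A AS; apply: (cstar_adjoint AS.1); exact: AX.
- move=> X AX A AS; apply: (cstar_lim AS.1) => eps /AX[Y AY YX].
  by exists Y => //; exact: AY.
Qed.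

Lemma conj_real_complex (R : realType) (x : R) : (x%:C : R[i])^* = x%:C.
Proof. exact: conjc_real. Qed.

#[local] Instance words_infty_filter n : Filter (words_infty n).
Proof.
apply: filter_from_filter; first by exists 0%N.
move=> N M _ _; exists (maxn N M) => // a /=.
by rewrite geq_max => /andP[].
Qed.

(** * The multishift: its defect operators and the rank one operators in its C*-algebra *)

Section Multishift.
Context {R : realType} {n : nat} {F2 : hilbertType R}.
Variables (e : seq 'I_n -> F2) (mu : seq 'I_n -> R) (W : 'I_n -> bop F2 F2).
Hypotheses (e_basis : orthonormal_basis e)
  (W_shift : weighted_left_multishift e mu W) (W_inj : forall i, injective (W i)).

Let A := cstar_gen (range W).
Let A_alg : cstar_subalgebra A := cstar_gen_subalgebra (range W).

Let A_shift i : A (W i).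
Proof. by move=> B [_]; apply; exists i. Qed.

Lemma multishiftE i a : W i (e a) = (mu (i :: a))%:C *: e (i :: a).
Proof. by case: W_shift. Qed.

Lemma weight_gt0 i a : 0 < mu (i :: a).
Proof.
rewrite lt_def; apply/andP; split; last by case: W_shift => + _ _; apply.
apply/eqP => mu0; have : e a = 0.
  by apply: (@W_inj i); rewrite multishiftE mu0 scale0r linear0.
move=> ea0; have := basis_dot e_basis a a; rewrite ea0 hdot0l eqxx => /esym/eqP.
by rewrite oner_eq0.
Qed.

Lemma adjoint_multishift_nil j : adjoint (W j) (e [::]) = 0.
Proof.
apply: (basis_eq e_basis) => a; rewrite -adjointE multishiftE hdotZl.
by rewrite (basis_dot e_basis) mulr0 hdot0r.
Qed.

Lemma adjoint_multishift_cons j i a :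
  adjoint (W j) (e (i :: a)) = ((j == i)%:R * (mu (i :: a))%:C) *: e a.
Proof.
apply: (basis_eq e_basis) => b; rewrite -adjointE multishiftE hdotZl hdotZr.
rewrite !(basis_dot e_basis) eqseq_cons rmorphM/= conj_real_complex rmorph_nat.
case: eqVneq => [<-|_]/=; last by rewrite mulr0 !mul0r.
by case: eqVneq => [->|_]; rewrite ?mulr0// mul1r.
Qed.

Definition range_sum : bop F2 F2 :=
  bop_sum (index_enum 'I_n) (fun j => bop_comp (W j) (adjoint (W j))).

Definition defect i : bop F2 F2 :=
  bop_lin (-1) range_sum (bop_comp (adjoint (W i)) (W i)).

(** Eigenvalues of [range_sum]; the value at the empty word is 0 because [e [::]] is orthogonal to
    the range of every [W j]. *)
Definition range_weight (a : seq 'I_n) : R := if a is [::] then 0 else mu a ^+ 2.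

Lemma diagonal_range_sum : diagonal_op e range_sum (fun a => (range_weight a)%:C).
Proof.
case=> [|i a]; rewrite bop_sumE.
  by rewrite scale0r big1// => j _; rewrite /= adjoint_multishift_nil linear0.
rewrite (bigD1 i)//= big1 => [|j /negPf ji].
  rewrite adjoint_multishift_cons eqxx mul1r bopZ multishiftE scalerA addr0.
  by rewrite -rmorphM -expr2.
by rewrite adjoint_multishift_cons ji mul0r scale0r linear0.
Qed.

Lemma diagonal_defect i :
  diagonal_op e (defect i) (fun a => (mu (i :: a) ^+ 2 - range_weight a)%:C).
Proof.
move=> a; rewrite bop_linE diagonal_range_sum /= multishiftE bopZ.
rewrite adjoint_multishift_cons eqxx mul1r scaleN1r scalerA addrC -scalerBl.
by rewrite rmorphB/= expr2 rmorphM.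
Qed.

Lemma range_sum_mem : A range_sum.
Proof.
by apply: (cstar_sum A_alg) => // j; apply: (cstar_comp A_alg) => //; exact: (cstar_adjoint A_alg).
Qed.

Lemma defect_mem i : A (defect i).
Proof.
apply: (cstar_lin A_alg) => //; first exact: range_sum_mem.
by apply: (cstar_comp A_alg) => //; exact: (cstar_adjoint A_alg).
Qed.

Section Limit.
Variables (i : 'I_n)
  (mu_lim : (mu (i :: a) - mu a) @[a --> words_infty n] --> (0 : R)).

Lemma weight_bounded : exists2 M, 0 < M & forall j a, mu (j :: a) <= M.
Proof.
have /boolp.choice[B Bmu] : forall j, exists B, forall a, mu (j :: a) <= B.
  case: W_shift => _ ub _ j; have [B Bub] := ub j; exists B => a.
  by apply: Bub; exists a.
exists (1 + \sum_j `|B j|); first by rewrite ltr_pwDl// sumr_ge0.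
move=> j a; rewrite (le_trans (Bmu j a))// (bigD1 j)//= addrCA.
by rewrite (le_trans (ler_norm _))// lerDl addr_ge0// sumr_ge0.
Qed.

(** A difference of squares: the difference of the weights tends to zero and their sum stays
    bounded. The strict inequality on lengths excludes the empty word. *)
Lemma defect_weight_cvg (eps : R[i]) : 0 < eps -> exists N, forall a,
  (N < size a)%N -> `|(mu (i :: a) ^+ 2 - range_weight a)%:C| <= eps.
Proof.
move=> eps0; have eE : (complex.Re eps)%:C = eps by rewrite RRe_real// gtr0_real.
have r0 : 0 < complex.Re eps by rewrite -ltcR eE.
have [M M0 muM] := weight_bounded.
have rM : 0 < complex.Re eps / (M + M) by rewrite divr_gt0// addr_gt0.
move/cvgrPdist_le: mu_lim => /(_ _ rM)[N _ Nmu]; exists N => -[//|j a] Na.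
rewrite norm_real_complex -eE lecR /range_weight subr_sqr normrM.
have := Nmu _ (ltnW Na); rewrite /= sub0r normrN => le1.
have le2 : `|mu (i :: j :: a) + mu (j :: a)| <= M + M.
  by rewrite ger0_norm ?addr_ge0 ?lerD// ltW// weight_gt0.
apply: le_trans (ler_pM (normr_ge0 _) (normr_ge0 _) le1 le2) _.
by rewrite divfK// gt_eqF// addr_gt0.
Qed.

(** The difference is diagonal, zero on short words and with small eigenvalues on long ones. Hence a
    representation that kills rank one operators also kills the defect. *)
Lemma defect_truncation (eps : R[i]) : 0 < eps -> exists N,
  opnorm_le (bop_lin (-1) (bop_comp (defect i) (truncation e N)) (defect i)) eps.
Proof.
move=> eps0; have [N Nd] := defect_weight_cvg eps0; exists N.+1.
apply: (opnorm_diagonal e_basis (diagonal_lin (-1) (diagonal_comp (diagonal_defect i)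
  (diagonal_truncation e_basis N.+1)) (diagonal_defect i))); first exact: ltW.
move=> a; rewrite /= ltnS; case: leqP => aN; first by rewrite mulr1 mulN1r addNr normr0 ltW.
by rewrite mulr0 mulr0 add0r Nd.
Qed.

(** Eigenvalue functions realised in the algebra; their closure properties reduce operator
    polynomials to pointwise computations. *)
Let diag_mem t := exists2 T, A T & diagonal_op e T t.

Let diag_mem_one : diag_mem (fun=> 1).
Proof. by exists (bop_id F2); [exact: (cstar_id A_alg)|move=> a; rewrite scale1r]. Qed.

Let diag_mem_mul s t : diag_mem s -> diag_mem t -> diag_mem (fun a => s a * t a).
Proof.
move=> [S AS Ss] [T AT Tt]; exists (bop_comp S T); first exact: (cstar_comp A_alg).
exact: diagonal_comp.
Qed.

Let diag_mem_lin c s t :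
  diag_mem s -> diag_mem t -> diag_mem (fun a => c * s a + t a).
Proof.
move=> [S AS Ss] [T AT Tt]; exists (bop_lin c S T); first exact: (cstar_lin A_alg).
exact: diagonal_lin.
Qed.

(* Diagonal polynomials in the defect [D] and in [E = range_sum]: the factor
   [prod_b (1 - E / m_b)], over the short nonempty words, equals [1] at the empty word
   and kills these short words, while [(D / d_[::])^k] decays geometrically on the long ones. *)
Lemma vacuum_projection_mem : A (bop_rank1 (e [::]) (e [::])).
Proof.
(* The eigenvalue of the defect at the empty word, positive by injectivity. *)
pose d0 : R[i] := (mu [:: i] ^+ 2)%:C.
have d0_gt0 : 0 < d0 by rewrite ltcR exprn_gt0// weight_gt0.
have d0h : 0 < d0 / 2%:R by rewrite divr_gt0.
have [N Nd] := defect_weight_cvg d0h.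
pose m a : R[i] := (range_weight a)%:C.
pose d a : R[i] := d0^-1 * (mu (i :: a) ^+ 2 - range_weight a)%:C.
pose s := [seq b <- words_below n N.+1 | b != [::]].
pose q a : R[i] := \prod_(b <- s) (1 - (m b)^-1 * m a).
have m_mem : diag_mem m by exists range_sum; [exact: range_sum_mem|exact: diagonal_range_sum].
have zero_mem : diag_mem (fun=> 0).
  exists (bop_zero F2); first exact: (cstar_zero A_alg).
  by move=> a; rewrite bop_zeroE scale0r.
have d_mem : diag_mem d.
  have := @diag_mem_lin d0^-1 _ _ (ex_intro2 _ _ _ (defect_mem i) (diagonal_defect i)) zero_mem.
  by rewrite /d; under [X in diag_mem X]eq_fun do rewrite addr0.
have q_mem : diag_mem q.
  rewrite /q; elim: (s) => [|b r IH].
    by under [X in diag_mem X]eq_fun do rewrite big_nil.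
  under [X in diag_mem X]eq_fun do rewrite big_cons.
  apply: diag_mem_mul => //; have := diag_mem_lin (- (m b)^-1) m_mem diag_mem_one.
  by under [X in diag_mem X]eq_fun do rewrite mulNr addrC.
have dk_mem k : diag_mem (fun a => d a ^+ k).
  elim: k => [|k IH]; first exact: diag_mem_one.
  by under [X in diag_mem X]eq_fun do rewrite exprS; exact: diag_mem_mul.
(* Boundedness of [q] is read off from a bounded operator with diagonal [q], without estimating the
   factors. *)
have [M M0 qM] : exists2 M : R[i], 0 <= M & forall a, `|q a| <= M.
  have [T _ Tq] := q_mem; have [M M0 TM] := bop_bounded T; exists M => // a.
  have := TM (e a); rewrite Tq normrZ.
  suff -> : `|e a| = 1 by rewrite !mulr1.
  by apply/eqP; rewrite -(@eqrXn2 _ 2)// hnormE (basis_dot e_basis) eqxx expr1n.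
apply: (cstar_lim A_alg) => eps eps0.
have [k ke] := half_pow_small M0 eps0.
have [T AT Tt] := diag_mem_mul (dk_mem k.+1) q_mem.
exists T => //; apply: (opnorm_diagonal e_basis
  (diagonal_lin (-1) Tt (diagonal_rank1 e_basis [::]))); first exact: ltW.
move=> a; have [->|a0] := eqVneq a [::].
  have -> : q [::] = 1 by rewrite /q big1// => b _; rewrite /m mulr0 subr0.
  rewrite /d subr0 mulVf ?gt_eqF// expr1n mulr1 mulN1r addNr normr0.
  exact: ltW.
rewrite addr0 mulN1r normrN normrM normrX.
have [aN|Na] := leqP (size a) N.
  (* The factor indexed by [a] itself vanishes, since [m a] is nonzero. *)
  have -> : q a = 0.
    have as_ : a \in s by rewrite mem_filter a0 mem_words_below.
    rewrite /q (bigD1_seq a)//=; last by rewrite filter_uniq// words_below_uniq.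
    rewrite mulVf ?subrr ?mul0r//.
    case: a a0 {aN as_} => // j a _; rewrite /m /range_weight gt_eqF//.
    by rewrite ltcR exprn_gt0// weight_gt0.
  by rewrite normr0 mulr0 ltW.
apply: le_trans ke; rewrite mulrC ler_pM// ?exprn_ge0//.
have dh : `|d a| <= 2%:R^-1.
  rewrite normrM normfV (gtr0_norm d0_gt0) ler_pdivrMl//; exact: Nd.
rewrite exprSr (le_trans (ler_pM _ _ (lerXn2r k _ _ dh) dh)) ?nnegrE ?exprn_ge0 ?invr_ge0//.
by rewrite ler_piMr ?exprn_ge0 ?invr_ge0// invf_le1// ler1n.
Qed.

(** Applying the [W j] to the vacuum projection and dividing by the positive weights gives every
    [e a (x) o]. Combinations and norm limits give every [z (x) o], and [x (x) y] is the product of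
    [x (x) o] with the adjoint of [y (x) o]. *)
Lemma rank1_mem x y : A (bop_rank1 x y).
Proof.
have Pe a : A (bop_rank1 (e a) (e [::])).
  elim: a => [|j a IH]; first exact: vacuum_projection_mem.
  have -> : bop_rank1 (e (j :: a)) (e [::]) = bop_lin (mu (j :: a))%:C^-1
      (bop_comp (W j) (bop_rank1 (e a) (e [::]))) (bop_zero F2).
    apply: bopP => z; rewrite comp_rank1 bop_linE bop_zeroE addr0 !bop_rank1E.
    rewrite multishiftE !scalerA mulrAC mulVf ?mul1r//.
    by rewrite gt_eqF// ltcR weight_gt0.
  by apply: (cstar_lin A_alg) => //; [exact: (cstar_comp A_alg)|exact: (cstar_zero A_alg)].
have Pl l : A (bop_rank1 (lin_comb e l) (e [::])).
  rewrite /lin_comb; elim: l => [|p l IH].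
    rewrite big_nil (_ : bop_rank1 _ _ = bop_zero F2); first exact: (cstar_zero A_alg).
    by apply: bopP => z; rewrite bop_zeroE bop_rank1E scaler0.
  rewrite big_cons (_ : bop_rank1 _ _ = bop_lin p.1 (bop_rank1 (e p.2) (e [::]))
    (bop_rank1 (\sum_(q <- l) q.1 *: e q.2) (e [::]))); first exact: (cstar_lin A_alg).
  apply: bopP => z; rewrite bop_linE !bop_rank1E scalerDr; congr (_ + _).
  by rewrite !scalerA mulrC.
have ne : `|e [::]| = 1.
  by apply/eqP; rewrite -(@eqrXn2 _ 2)// hnormE (basis_dot e_basis) expr1n.
have Px z : A (bop_rank1 z (e [::])).
  apply: (cstar_lim A_alg) => eps eps0.
  have ez : cs_set (closed_span (range e)) z by rewrite e_basis.2.
  have [_ /lin_comb_span[l ->] zl] := closed_span_approx ez eps0.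
  exists (bop_rank1 (lin_comb e l) (e [::])) => //.
  have -> : bop_lin (-1) (bop_rank1 (lin_comb e l) (e [::])) (bop_rank1 z (e [::])) =
      bop_rank1 (z - lin_comb e l) (e [::]).
    by apply: bopP => u; rewrite bop_linE !bop_rank1E scaleN1r addrC scalerBr.
  move=> u; rewrite (le_trans (opnorm_rank1 _ _ _))// ne mulr1 ler_wpM2r//.
  exact: ltW.
have -> : bop_rank1 x y =
    bop_comp (bop_rank1 x (e [::])) (adjoint (bop_rank1 y (e [::]))).
  apply: bopP => u; rewrite /= adjoint_rank1 !bop_rank1E hdotZl.
  by rewrite (basis_dot e_basis) mulr1.
by apply: (cstar_comp A_alg) => //; exact: (cstar_adjoint A_alg).
Qed.

End Limit.

End Multishift.

Lemma le_eps_eq0 (R : realType) (V : normedZmodType R[i]) (z : V) (c : R[i]) :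
  0 <= c -> (forall eps, 0 < eps -> `|z| <= eps * c) -> z = 0.
Proof.
move=> c0 zc; apply/eqP; rewrite -normr_le0; apply/ler_addgt0Pr => eps eps0.
have c1 : 0 < c + 1 by rewrite ltr_wpDl.
rewrite add0r (le_trans (zc _ (divr_gt0 eps0 c1)))// mulrAC ler_pdivrMr//.
by rewrite ler_wpM2l ?lerDl// ltW.
Qed.

(** * Compression of operators and representations to closed subspaces *)

Section Compression.
Context {R : realType} {K : hilbertType R} (M : csubspace K).

(** Defined for every closed subspace and compatible with adjoints in general; on an invariant
    subspace it is the restriction. *)
Definition compress (T : bop K K) : bop (sub_hilbert M) (sub_hilbert M) :=
  bop_comp (bop_proj M) (bop_comp T (bop_incl M)).

Lemma compressE (T : bop K K) (x : sub_hilbert M) :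
  cs_set M (T (csval x)) -> csval (compress T x) = T (csval x).
Proof. by move=> MTx; rewrite /compress /= bop_inclE bop_projK. Qed.

Lemma adjoint_compress (T : bop K K) : adjoint (compress T) = compress (adjoint T).
Proof.
by rewrite /compress !adjoint_comp adjointK; apply: bopP => x.
Qed.

Lemma compress_rep (H : hilbertType R) (A : set (bop H H)) (pi : bop H H -> bop K K) :
  cstar_subalgebra A -> unital_star_rep A pi ->
  (forall X x, A X -> cs_set M x -> cs_set M (pi X x)) ->
  unital_star_rep A (fun X => compress (pi X)).
Proof.
move=> A_alg pi_rep Minv.
have compE X (x : sub_hilbert M) : A X -> csval (compress (pi X) x) = pi X (csval x).
  by move=> AX; apply: compressE; apply: Minv => //; exact: csval_mem.
split=> [|a X Y AX AY|X Y AX AY|X AX].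
- by apply: bopP => x; apply: val_inj; rewrite /= compE ?(rep_id pi_rep)//; exact: cstar_id.
- have AXY := cstar_lin A_alg a AX AY.
  by apply: bopP => x; apply: val_inj; rewrite /= !compE// (rep_lin pi_rep).
- have AXY := cstar_comp A_alg AX AY.
  by apply: bopP => x; apply: val_inj; rewrite /= !compE// (rep_comp pi_rep).
- by rewrite (rep_adjoint pi_rep)// adjoint_compress.
Qed.

End Compression.

(** * Decomposition of a representation into its compact and singular parts *)

Section RepresentationDecomposition.
Context {R : realType} {n : nat} {F2 K : hilbertType R}.
Variables (e : seq 'I_n -> F2) (A : set (bop F2 F2)) (pi : bop F2 F2 -> bop K K).
Hypotheses (e_basis : orthonormal_basis e) (A_alg : cstar_subalgebra A)
  (A_rank1 : forall x y, A (bop_rank1 x y)) (pi_rep : unital_star_rep A pi).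

Let o := e [::].

Let oo : '[o, o] = 1. Proof. by rewrite (basis_dot e_basis). Qed.

Definition vacuum_proj : bop K K := pi (bop_rank1 o o).

(* For [g] in the range of [vacuum_proj], [creation x g] plays the role of the
   elementary tensor of [x] and [g]. *)
Definition creation x : bop K K := pi (bop_rank1 x o).

Lemma rep_creation X x g : A X -> pi X (creation x g) = creation (X x) g.
Proof. by move=> AX; rewrite -(rep_comp pi_rep)// comp_rank1. Qed.

Lemma creation_lin a x y g :
  creation (a *: x + y) g = a *: creation x g + creation y g.
Proof.
rewrite -(rep_lin pi_rep)//; congr (pi _ _); apply: bopP => z.
by rewrite bop_linE !bop_rank1E scalerDr !scalerA mulrC.
Qed.

Lemma creation0 g : creation 0 g = 0.
Proof. by have := creation_lin (-1) 0 0 g; rewrite scaler0 addr0 scaleN1r addNr. Qed.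

Lemma creationZ a x g : creation (a *: x) g = a *: creation x g.
Proof. by have := creation_lin a x 0 g; rewrite creation0 !addr0. Qed.

(** [(x (x) o) (o (x) y) = x (x) y] because [o] is a unit vector, so ranges of represented rank one
    operators consist of creation vectors. *)
Lemma creation_rank1 x y g :
  creation x (pi (bop_rank1 o y) g) = pi (bop_rank1 x y) g.
Proof.
rewrite -(rep_comp pi_rep)//; congr (pi _ _); apply: bopP => z.
by rewrite /= !bop_rank1E hdotZl oo mulr1.
Qed.

(** The adjoint of [y (x) o] times [x (x) o] is [<x, y>] times the vacuum projection. *)
Lemma creation_dot x y g h :
  '[creation x g, creation y h] = '[x, y] * '[vacuum_proj g, h].
Proof.
rewrite adjointEr -(rep_adjoint pi_rep)// adjoint_rank1 rep_creation//.
by rewrite bop_rank1E creationZ hdotZl.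
Qed.

Lemma creation_compact x g : cs_set (compact_part A pi) (creation x g).
Proof.
apply: closed_span_incl; exists (bop_rank1 x o), g.
by split=> //; exact: compact_op_rank1.
Qed.

(** By [rep_bounded], [pi X y] is within [2 * eps * |y|] of the image of [y] under a represented
    truncation of [X], which is a sum of creation vectors. *)
Lemma rep_compact_orth v X y : (forall x g, '[creation x g, v] = 0) ->
  A X -> compact_op X -> '[pi X y, v] = 0.
Proof.
move=> vE AX Xc.
apply: (@le_eps_eq0 R R[i] _ (2%:R * `|y| * `|v|)) => [|eps eps0].
  by rewrite !mulr_ge0.
have [N XN] := compact_op_approx e_basis Xc eps0.
have AT : A (truncation e N) by apply: (cstar_sum A_alg).
have ATX : A (bop_comp (truncation e N) X) by apply: (cstar_comp A_alg).
have := rep_bounded A_alg pi_rep (cstar_lin A_alg (-1) ATX AX) eps0 XN y.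
rewrite (rep_lin pi_rep)// scaleN1r; set z := pi (bop_comp _ _) y => Xz.
have zv : '[z, v] = 0.
  rewrite /z (rep_comp pi_rep)// (rep_sum A_alg pi_rep)// hdot_suml big1// => a _.
  by rewrite -creation_rank1.
rewrite -[X in `|X|]add0r -[X in X + _]oppr0 -zv -hdotNl -hdotDl.
rewrite (le_trans (hCauchySchwarz _ _))// (le_trans (ler_wpM2r _ Xz))//.
by rewrite [leLHS](_ : _ = eps * (2%:R * `|y| * `|v|))//; ring.
Qed.

(** Creation vectors already span the compact part. The dual form, a test by orthogonality, lets
    operators be moved across the inner product by their adjoints. *)
Lemma compact_partP z : cs_set (compact_part A pi) z <->
  forall v, (forall x g, '[creation x g, v] = 0) -> '[z, v] = 0.
Proof.
split=> [/closed_spanP zK v vE|zE]; last first.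
  apply/closed_spanP => v vK; apply: zE => x g; apply: vK.
  by exists (bop_rank1 x o), g; split=> //; exact: compact_op_rank1.
by apply: zK => _ [X [y [AX Xc ->]]]; exact: rep_compact_orth.
Qed.

Lemma singular_partP v : cs_set (singular_part A pi) v <->
  forall x g, '[creation x g, v] = 0.
Proof.
split=> [vK x g|vE z /compact_partP zP].
  by rewrite hdotC vK ?conjC0//; exact: creation_compact.
by rewrite hdotC zP ?conjC0.
Qed.

Lemma compact_part_inv X z : A X ->
  cs_set (compact_part A pi) z -> cs_set (compact_part A pi) (pi X z).
Proof.
move=> AX /compact_partP zK; apply/compact_partP => v vE.
rewrite adjointE -(rep_adjoint pi_rep)//; apply: zK => x g.
by rewrite (rep_adjoint pi_rep)// -adjointE rep_creation.
Qed.

Lemma singular_part_inv X v : A X ->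
  cs_set (singular_part A pi) v -> cs_set (singular_part A pi) (pi X v).
Proof.
move=> AX /singular_partP vK; apply/singular_partP => x g.
by rewrite adjointEr -(rep_adjoint pi_rep)// rep_creation//; exact: cstar_adjoint.
Qed.

(** The vector [pi X v] lies in the compact part and, by invariance, in its orthogonal
    complement. *)
Lemma singular_part_compact X v : A X -> compact_op X ->
  cs_set (singular_part A pi) v -> pi X v = 0.
Proof.
move=> AX Xc vK; apply: hdot_eq0; apply: (singular_part_inv AX vK).
by apply: closed_span_incl; exists X, v.
Qed.

Lemma compact_singular_orth x y : cs_set (compact_part A pi) x ->
  cs_set (singular_part A pi) y -> '[x, y] = 0.
Proof. by move=> xK yK; rewrite hdotC yK// conjC0. Qed.

Let K0 := compact_part A pi.
Let K1 := singular_part A pi.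

Definition compact_rep X := compress K0 (pi X).
Definition singular_rep X := compress K1 (pi X).

Lemma compact_repE X (x : sub_hilbert K0) : A X ->
  csval (compact_rep X x) = pi X (csval x).
Proof.
by move=> AX; rewrite compressE//; apply: compact_part_inv => //; exact: csval_mem.
Qed.

Lemma singular_repE X (x : sub_hilbert K1) : A X ->
  csval (singular_rep X x) = pi X (csval x).
Proof.
by move=> AX; rewrite compressE//; apply: singular_part_inv => //; exact: csval_mem.
Qed.

Lemma compact_rep_rep : unital_star_rep A compact_rep.
Proof. by apply: compress_rep => // X x; exact: compact_part_inv. Qed.

Lemma singular_rep_rep : unital_star_rep A singular_rep.
Proof. by apply: compress_rep => // X x; exact: singular_part_inv. Qed.

Lemma compact_singular_direct_sum : rep_direct_sum A pi compact_rep singular_rep.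
Proof.
split=> [x y|z|X AX x y].
- by apply: compact_singular_orth; exact: csval_mem.
- have zK1 : cs_set K1 (z - csval (bop_proj K0 z)) by exact: bop_proj_orth.
  have [y yE] := csval_ex zK1; exists (bop_proj K0 z), y.
  by rewrite yE addrC subrK.
- by rewrite linearD/= compact_repE// singular_repE.
Qed.

Lemma singular_rep_compact X : A X -> compact_op X -> forall x, singular_rep X x = 0.
Proof.
move=> AX Xc x; apply: val_inj; rewrite /= singular_repE// singular_part_compact//.
exact: csval_mem.
Qed.

(** Rank one operators vanish on subrepresentations of the singular part, hence on whatever is
    equivalent to one. A vector of the compact part killed by every [pi (o (x) y)] is orthogonal to
    all creation vectors, so it is zero. *)
Lemma compact_singular_disjoint : disjoint_reps A compact_rep singular_rep.
Proof.
move=> M M' rho rho' rhoE rho'E [x Mx x0] [U [Uiso _] Urho].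
have [x' x'E] := csval_ex Mx; case/eqP: x0; apply: val_inj => /=.
apply: hdot_eq0; have /compact_partP := csval_mem x; apply => y g.
rewrite adjointE -(rep_adjoint pi_rep)// adjoint_rank1.
have AX : A (bop_rank1 o y) by [].
suff rho0 : rho (bop_rank1 o y) x' = 0.
  rewrite -compact_repE//; have := rhoE _ AX x'; rewrite rho0 x'E => <-.
  exact: hdot0r.
apply: hdot_eq0; rewrite -Uiso.
have := congr1 (fun T : bop _ _ => T x') (Urho _ AX) => /= ->.
have -> : rho' (bop_rank1 o y) (U x') = 0.
  by apply: val_inj; rewrite /= rho'E// singular_rep_compact//; exact: compact_op_rank1.
exact: hdot0l.
Qed.

Lemma vacuum_proj_adjoint : adjoint vacuum_proj = vacuum_proj.
Proof. by rewrite -(rep_adjoint pi_rep)// adjoint_rank1. Qed.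

Lemma creation_vacuum x g : creation x (vacuum_proj g) = creation x g.
Proof. exact: creation_rank1. Qed.

(** The range of [vacuum_proj], as the orthogonal complement of the range of [1 - vacuum_proj],
    which makes it closed at once. *)
Definition vacuum_space : csubspace K :=
  orth_compl [set y - vacuum_proj y | y in setT].

Lemma vacuum_spaceP g : cs_set vacuum_space g <-> vacuum_proj g = g.
Proof.
split=> [gV|gE _ [y _ <-]]; last first.
  by rewrite hdotBr adjointEr vacuum_proj_adjoint gE subrr.
apply: hdot_injl => y; have : '[g, y - vacuum_proj y] = 0 by apply: gV; exists y.
rewrite hdotBr adjointEr vacuum_proj_adjoint => /eqP.
by rewrite subr_eq0 eq_sym => /eqP.
Qed.

Let G := sub_hilbert vacuum_space.

Definition vacuum_tensor (x : F2) (g : G) : sub_hilbert K0 :=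
  bop_proj K0 (creation x (csval g)).

Lemma vacuum_tensorE x g : csval (vacuum_tensor x g) = creation x (csval g).
Proof. by rewrite bop_projK//; exact: creation_compact. Qed.

Lemma vacuum_tensor_dot x x' y y' :
  '[vacuum_tensor x y, vacuum_tensor x' y'] = '[x, x'] * '[y, y'].
Proof.
rewrite -!hdot_csval !vacuum_tensorE creation_dot.
by have /vacuum_spaceP -> := csval_mem y.
Qed.

(** Creation vectors span the compact part, and [creation x g] depends only on [vacuum_proj g]. *)
Lemma vacuum_tensor_total :
  cs_set (closed_span [set vacuum_tensor p.1 p.2 | p in setT]) = setT.
Proof.
apply/total_familyP => v vE; apply: val_inj; apply: hdot_eq0.
have /compact_partP := csval_mem v; apply => x g.
have gV : cs_set vacuum_space (vacuum_proj g).
  apply/vacuum_spaceP; rewrite -(rep_comp pi_rep)// comp_rank1 bop_rank1E.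
  by rewrite oo scale1r.
have [g' g'E] := csval_ex gV.
have := vE (x, g'); rewrite -hdot_csval vacuum_tensorE/= g'E.
by rewrite creation_vacuum.
Qed.

Fact vacuum_tensor_linl g : GRing.linear_for *:%R (vacuum_tensor^~ g).
Proof.
by move=> a x y; apply: val_inj; rewrite /= !vacuum_tensorE creation_lin.
Qed.

Fact vacuum_tensor_linr x : GRing.linear_for *:%R (vacuum_tensor x).
Proof.
by move=> a y z; apply: val_inj; rewrite /= !vacuum_tensorE/= linearP.
Qed.

(** The compact part with [vacuum_tensor] is itself a model of the tensor product, so the
    intertwining unitary is the identity. *)
Lemma compact_rep_ampliation : ampliation A compact_rep G.
Proof.
pose m := bilinear_isBilinear.Build R[i] F2 G (sub_hilbert K0) *:%R *:%R
  vacuum_tensor (pair vacuum_tensor_linl vacuum_tensor_linr).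
pose f : {bilinear F2 -> G -> sub_hilbert K0} := HB.pack vacuum_tensor m.
pose T := @HilbertTensor R F2 G (sub_hilbert K0) f vacuum_tensor_dot vacuum_tensor_total.
exists T, compact_rep; split.
  move=> X AX x y; apply: val_inj; rewrite /= compact_repE// !vacuum_tensorE.
  by rewrite rep_creation.
exists (bop_id (sub_hilbert K0)); last by move=> X _; exact: bopP.
by split=> //; apply/seteqP; split=> // x _; exists x.
Qed.

Section Uniqueness.
Variables (pi0 : bop F2 F2 -> bop (sub_hilbert K0) (sub_hilbert K0))
  (pi1 : bop F2 F2 -> bop (sub_hilbert K1) (sub_hilbert K1)).
Hypothesis pi_sum : rep_direct_sum A pi pi0 pi1.

Lemma direct_sum_compactE X x : A X -> csval (pi0 X x) = pi X (csval x).
Proof.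
case: pi_sum => _ _ h AX; have := h X AX x 0.
by rewrite linear0 !addr0.
Qed.

Lemma direct_sum_singularE X y : A X -> csval (pi1 X y) = pi X (csval y).
Proof.
case: pi_sum => _ _ h AX; have := h X AX 0 y.
by rewrite linear0 !add0r.
Qed.

(** The isometry sends [g] to the preimage of [o (x) g] under the unitary of the ampliation. Its
    range is that of the vacuum projection, so every ampliation has the same multiplicity space up
    to a unitary. *)
Lemma ampliation_isometry (G' : hilbertType R) : ampliation A pi0 G' ->
  exists2 j : bop G' K, cancel j (adjoint j) &
    forall z, j (adjoint j z) = vacuum_proj z.
Proof.
move=> [T [rho [rhoE [Phi uPhi PhiE]]]].
have ht_lin : linear (ht_map T o : G' -> T) by move=> a g h; rewrite linearPr.
have ht_norm g : `|ht_map T o g| <= 1 * `|g|.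
  by apply: hnorm_le_dot => //; rewrite ht_dot oo expr1n.
have [J JE] := bop_ext_ex ht_lin ler01 ht_norm.
have JK : cancel J (adjoint J).
  by move=> g; apply: hdot_injl => h; rewrite -adjointEr !JE ht_dot oo mul1r.
(* Both sides act as the vacuum projection on the first tensor factor, which is checked on
   elementary tensors. *)
have JJ : bop_comp J (adjoint J) = rho (bop_rank1 o o).
  apply: (@bop_eq_total _ _ _ _ (fun p : F2 * G' => ht_map T p.1 p.2)).
    by apply/total_familyP; exact: ht_total.
  move=> [x g]; rewrite /= rhoE// bop_rank1E linearZl_LR/= -JE -linearZ/=.
  congr (J _); apply: hdot_injl => h.
  by rewrite -adjointEr JE ht_dot hdotZl.
exists (bop_comp (bop_incl K0) (bop_comp (adjoint Phi) J)) => [g|z].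
  rewrite !adjoint_comp adjointK /= bop_inclE csvalK unitaryVK//.
have [orth dec _] := pi_sum; have [x [y ->]] := dec z.
rewrite !adjoint_comp adjointK /= bop_inclE.
have -> : adjoint (bop_incl K0) (csval x + csval y) = x.
  apply: hdot_injl => w; rewrite bop_projE hdotDl [X in _ + X]hdotC orth.
  by rewrite conjC0 addr0.
have := congr1 (fun S : bop _ _ => S (Phi x)) JJ => /= ->.
have AP : A (bop_rank1 o o) by [].
have := congr1 (fun S : bop _ _ => S x) (PhiE _ AP) => /= <-.
rewrite unitaryK// direct_sum_compactE// linearD/=.
rewrite [X in _ + X]singular_part_compact ?addr0//; first exact: compact_op_rank1.
exact: csval_mem.
Qed.

End Uniqueness.

End RepresentationDecomposition.

(** * Intertwining unitaries and classification up to equivalence *)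

Section UnitaryEquivalence.
Context {R : realType} {n : nat} {F2 K K' : hilbertType R}.
Variables (e : seq 'I_n -> F2) (A : set (bop F2 F2))
  (pi : bop F2 F2 -> bop K K) (pi' : bop F2 F2 -> bop K' K').
Hypotheses (e_basis : orthonormal_basis e) (A_alg : cstar_subalgebra A)
  (A_rank1 : forall x y, A (bop_rank1 x y))
  (pi_rep : unital_star_rep A pi) (pi_rep' : unital_star_rep A pi').

Lemma intertwiner_adjoint (U : bop K K') : unitary U ->
  (forall X, A X -> bop_comp U (pi X) = bop_comp (pi' X) U) ->
  forall X, A X -> bop_comp (adjoint U) (pi' X) = bop_comp (pi X) (adjoint U).
Proof.
move=> uU UE X AX; apply: bopP => y /=; rewrite -{1}(unitaryVK uU y).
have := congr1 (fun T : bop _ _ => T (adjoint U y)) (UE _ AX) => /= <-.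
exact: unitaryK.
Qed.

(** Every creation vector of [pi'] is the image under [U] of one of [pi]. *)
Lemma intertwiner_singular (U : bop K K') : unitary U ->
  (forall X, A X -> bop_comp U (pi X) = bop_comp (pi' X) U) ->
  forall v, cs_set (singular_part A pi) v -> cs_set (singular_part A pi') (U v).
Proof.
move=> uU UE v /(singular_partP e_basis A_alg A_rank1 pi_rep) vK.
apply/(singular_partP e_basis A_alg A_rank1 pi_rep') => x g.
rewrite -(unitaryVK uU g).
have := congr1 (fun T : bop _ _ => T (adjoint U g)) (UE _ (A_rank1 x (e [::]))).
by move=> /= <-; rewrite uU.1; exact: vK.
Qed.

End UnitaryEquivalence.

Section Classification.
Context {R : realType} {n : nat} {F2 K K' G G' : hilbertType R}.
Variables (e : seq 'I_n -> F2) (A : set (bop F2 F2))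
  (pi : bop F2 F2 -> bop K K) (pi' : bop F2 F2 -> bop K' K').
Hypotheses (e_basis : orthonormal_basis e) (A_alg : cstar_subalgebra A)
  (A_rank1 : forall x y, A (bop_rank1 x y))
  (pi_rep : unital_star_rep A pi) (pi_rep' : unital_star_rep A pi').

Let K1 := singular_part A pi.
Let K1' := singular_part A pi'.

Variables (pi1 : bop F2 F2 -> bop (sub_hilbert K1) (sub_hilbert K1))
  (pi1' : bop F2 F2 -> bop (sub_hilbert K1') (sub_hilbert K1'))
  (j : bop G K) (j' : bop G' K').
Hypotheses
  (pi1E : forall X y, A X -> csval (pi1 X y) = pi X (csval y))
  (pi1'E : forall X y, A X -> csval (pi1' X y) = pi' X (csval y))
  (jK : cancel j (adjoint j)) (jV : forall z, j (adjoint j z) = vacuum_proj e pi z)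
  (jK' : cancel j' (adjoint j'))
  (jV' : forall z, j' (adjoint j' z) = vacuum_proj e pi' z).

Let vacuum_j g : vacuum_proj e pi (j g) = j g.
Proof. by rewrite -jV jK. Qed.

Let vacuum_j' g : vacuum_proj e pi' (j' g) = j' g.
Proof. by rewrite -jV' jK'. Qed.

(** The unitary is [j'^* U j]: [U] intertwines the vacuum projections [j j^*] and [j' j'^*], and [j]
    and [j'] are isometries. *)
Lemma unitarily_equivalent_multiplicity :
  unitarily_equivalent A pi pi' -> exists V : bop G G', unitary V.
Proof.
move=> [U uU UE]; have UVE := intertwiner_adjoint uU UE.
have AP := A_rank1 (e [::]) (e [::]).
exists (bop_comp (adjoint j') (bop_comp U j)); apply: cancel_unitary => g.
  rewrite !adjoint_comp adjointK /= jV'.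
  have := congr1 (fun T : bop _ _ => T (j g)) (UE _ AP) => /= <-.
  by rewrite unitaryK// -[pi _ _]/(vacuum_proj e pi (j g)) vacuum_j jK.
rewrite !adjoint_comp adjointK /= jV.
have := congr1 (fun T : bop _ _ => T (j' g)) (UVE _ AP) => /= <-.
by rewrite unitaryVK// -[pi' _ _]/(vacuum_proj e pi' (j' g)) vacuum_j' jK'.
Qed.

Lemma unitarily_equivalent_singular :
  unitarily_equivalent A pi pi' -> unitarily_equivalent A pi1 pi1'.
Proof.
move=> [U uU UE]; have UVE := intertwiner_adjoint uU UE.
have UK v : cs_set K1 v -> cs_set K1' (U v).
  exact: (intertwiner_singular e_basis A_alg A_rank1 pi_rep pi_rep' uU UE).
have UVK v : cs_set K1' v -> cs_set K1 (adjoint U v).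
  exact: (intertwiner_singular e_basis A_alg A_rank1 pi_rep' pi_rep
    (unitary_adjoint uU) UVE).
pose U1 := bop_comp (bop_proj K1') (bop_comp U (bop_incl K1)).
have U1E x : csval (U1 x) = U (csval x).
  by rewrite /U1 /= bop_inclE bop_projK//; apply: UK; exact: csval_mem.
have U1VE x : csval (adjoint U1 x) = adjoint U (csval x).
  rewrite /U1 !adjoint_comp adjointK /= bop_inclE bop_projK//.
  by apply: UVK; exact: csval_mem.
exists U1.
  by apply: cancel_unitary => x; apply: val_inj; rewrite /= ?U1VE ?U1E ?U1VE ?unitaryK ?unitaryVK.
move=> X AX; apply: bopP => x; apply: val_inj; rewrite /= U1E pi1E// pi1'E// U1E.
exact: (congr1 (fun T : bop _ _ => T (csval x)) (UE _ AX)).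
Qed.

(** Creation vectors at [j g] and the singular part form a total family of [K], matched in [K']
    through [V] and [U1] with the same Gram matrix. The resulting unitary intertwines because [X]
    acts on the indices: [(x, g)] goes to [(X x, g)], and [y] to [pi1 X y]. *)
Lemma unitarily_equivalent_glue (V : bop G G') : unitary V ->
  unitarily_equivalent A pi1 pi1' -> unitarily_equivalent A pi pi'.
Proof.
move=> uV [U1 uU1 U1E].
pose fam (L D : hilbertType R) (rho : bop F2 F2 -> bop L L) (M : csubspace L)
    (i : bop D L) (f : G -> D) (h : sub_hilbert K1 -> sub_hilbert M)
    (p : F2 * G + sub_hilbert K1) : L :=
  match p with
  | inl q => creation e rho q.1 (i (f q.2))
  | inr y => csval (h y) end.
pose k := fam K G pi K1 j id id.
pose k' := fam K' G' pi' K1' j' V U1.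
(* [creation x] sees only the vacuum component of its argument, which lies in the range of [j]. *)
have creation_j x z : creation e pi x z = creation e pi x (j (adjoint j z)).
  by rewrite jV (creation_vacuum e_basis A_rank1 pi_rep).
have creation_j' x z : creation e pi' x z = creation e pi' x (j' (adjoint j' z)).
  by rewrite jV' (creation_vacuum e_basis A_rank1 pi_rep').
have kT : total_family k.
  move=> v kv; have vK : cs_set K1 v.
    apply/(singular_partP e_basis A_alg A_rank1 pi_rep) => x g.
    by rewrite creation_j; exact: (kv (inl (x, adjoint j g))).
  have [y yE] := csval_ex vK; apply: hdot_eq0; rewrite -{1}yE.
  exact: (kv (inr y)).
have kT' : total_family k'.
  move=> v kv; have vK : cs_set K1' v.
    apply/(singular_partP e_basis A_alg A_rank1 pi_rep') => x g.
    rewrite creation_j' -(unitaryVK uV (adjoint j' g)).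
    exact: (kv (inl (x, adjoint V (adjoint j' g)))).
  have [y yE] := csval_ex vK; apply: hdot_eq0; rewrite -{1}yE -(unitaryVK uU1 y).
  exact: (kv (inr (adjoint U1 y))).
have orth x g y : '[creation e pi x g, csval (y : sub_hilbert K1)] = 0.
  by have /(singular_partP e_basis A_alg A_rank1 pi_rep) := csval_mem y; apply.
have orth' x g y : '[creation e pi' x g, csval (y : sub_hilbert K1')] = 0.
  by have /(singular_partP e_basis A_alg A_rank1 pi_rep') := csval_mem y; apply.
have kk' a b : '[k a, k b] = '[k' a, k' b].
  case: a b => [[x g]|y] [[x' g']|y'] /=.
  - rewrite (creation_dot e A_rank1 pi_rep).
    rewrite (creation_dot e A_rank1 pi_rep') vacuum_j vacuum_j'.
    by rewrite (adjointE j) (adjointE j') jK jK' uV.1.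
  - by rewrite orth orth'.
  - by rewrite hdotC orth [RHS]hdotC orth'.
  - by rewrite !hdot_csval uU1.1.
have [U uU Uk] := gram_unitary kk' kT kT'.
exists U => // X AX; apply: (bop_eq_total kT) => -[[x g]|y] /=.
  rewrite (rep_creation e A_rank1 pi_rep)// (Uk (inl (X x, g))) (Uk (inl (x, g))) /=.
  by rewrite (rep_creation e A_rank1 pi_rep').
rewrite -pi1E// (Uk (inr (pi1 X y))) (Uk (inr y)) /= -pi1'E//.
by congr csval; exact: (congr1 (fun T : bop _ _ => T y) (U1E _ AX)).
Qed.

End Classification.

(** * Hilbert space dimension and unitaries *)

Lemma unitary_hdim_eq (R : realType) (G G' : hilbertType R) (V : bop G G') :
  unitary V -> hdim_eq G G'.
Proof.
move=> uV; have [I [f fB]] := orthonormal_basis_ex G.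
exists I, I, f, (V \o f); split=> //.
split=> [a b|]; first by rewrite /= uV.1 (basis_dot fB).
apply/total_familyP => v vV; rewrite -(unitaryVK uV v) (_ : adjoint V v = 0) ?linear0//.
by apply: (basis_total fB) => a; rewrite -adjointE; exact: vV.
Qed.

(** Orthonormal bases matched by a bijection have the same Gram matrix. *)
Lemma hdim_eq_unitary (R : realType) (G G' : hilbertType R) :
  hdim_eq G G' -> exists V : bop G G', unitary V.
Proof.
move=> [I [J [f [f' [fB f'B /card_eqP[s]]]]]].
have s_inj : injective s by move=> a b; apply: 'inj_s; rewrite inE.
pose k (a : set_type [set: I]) := f (val a).
pose k' (a : set_type [set: I]) := f' (val (s a)).
have [a b|v vk|v vk|V uV _] := @gram_unitary _ _ _ _ k k'.
- rewrite (basis_dot fB) (basis_dot f'B).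
  by rewrite !(inj_eq val_inj) (inj_eq s_inj).
- apply: (basis_total fB) => a; exact: (vk (SigSub (in_setT a))).
- apply: (basis_total f'B) => b.
  have [//|a _ sa] := @surj _ _ _ _ s (SigSub (in_setT b)).
  by have := vk a; rewrite /k' sa.
- by exists V.
Qed.

Theorem theorem1p15 (R : realType) (n : nat) (F2 : hilbertType R)
    (e : seq 'I_n -> F2) (mu : seq 'I_n -> R) (W : 'I_n -> bop F2 F2)
    (Omega : set 'I_n)
    (n_ge1 : (1 <= n)%N)
    (e_basis : orthonormal_basis e)
    (W_shift : weighted_left_multishift e mu W)
    (W_inj : forall i, injective (W i))
    (Omega_neq0 : Omega !=set0)
    (mu_lim : forall i, Omega i ->
      (mu (i :: a) - mu a) @[a --> words_infty n] --> (0 : R)) :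
  let A := cstar_gen (range W) in
  (forall (K : hilbertType R) (pi : bop F2 F2 -> bop K K),
    separable K -> unital_star_rep A pi ->
    let K0 := compact_part A pi in
    let K1 := singular_part A pi in
    exists (pi0 : bop F2 F2 -> bop (sub_hilbert K0) (sub_hilbert K0))
           (pi1 : bop F2 F2 -> bop (sub_hilbert K1) (sub_hilbert K1)),
      [/\ rep_direct_sum A pi pi0 pi1,
          unital_star_rep A pi0,
          unital_star_rep A pi1 &
          disjoint_reps A pi0 pi1] /\
      [/\ exists G : hilbertType R, ampliation A pi0 G,
          forall X, A X -> compact_op X -> forall x, pi1 X x = 0 &
          let V j := pi1 (W j) in
          forall i, Omega i -> forall x,
            bop_comp (adjoint (V i)) (V i) x =
            \sum_(j < n) bop_comp (V j) (adjoint (V j)) x]) /\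
  (forall (K K' : hilbertType R)
      (pi : bop F2 F2 -> bop K K) (pi' : bop F2 F2 -> bop K' K')
      (pi0 : bop F2 F2 -> bop (sub_hilbert (compact_part A pi))
                              (sub_hilbert (compact_part A pi)))
      (pi1 : bop F2 F2 -> bop (sub_hilbert (singular_part A pi))
                              (sub_hilbert (singular_part A pi)))
      (pi0' : bop F2 F2 -> bop (sub_hilbert (compact_part A pi'))
                               (sub_hilbert (compact_part A pi')))
      (pi1' : bop F2 F2 -> bop (sub_hilbert (singular_part A pi'))
                               (sub_hilbert (singular_part A pi')))
      (G G' : hilbertType R),
    separable K -> unital_star_rep A pi ->
    rep_direct_sum A pi pi0 pi1 -> ampliation A pi0 G ->
    separable K' -> unital_star_rep A pi' ->
    rep_direct_sum A pi' pi0' pi1' -> ampliation A pi0' G' ->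
    (unitarily_equivalent A pi pi' <->
     hdim_eq G G' /\ unitarily_equivalent A pi1 pi1')).
Proof.
move=> A; have A_alg : cstar_subalgebra A := cstar_gen_subalgebra (range W).
have [i0 Oi0] := Omega_neq0.
(* A single index of [Omega] yields all rank one operators. *)
have A_rank1 : forall x y, A (bop_rank1 x y).
  exact: (rank1_mem e_basis W_shift W_inj (mu_lim i0 Oi0)).
have A_shift i : A (W i) by move=> B [_]; apply; exists i.
split=> [K pi _ pi_rep K0 K1|].
  exists (compact_rep A pi), (singular_rep A pi).
  have pi1_rep := singular_rep_rep e_basis A_alg A_rank1 pi_rep.
  have pi1_compact := singular_rep_compact e_basis A_alg A_rank1 pi_rep.
  split; split.
  - exact: (compact_singular_direct_sum e_basis).
  - exact: (compact_rep_rep e_basis).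
  - exact: pi1_rep.
  - exact: (compact_singular_disjoint e_basis).
  - by eexists; exact: (compact_rep_ampliation e_basis).
  - by move=> X AX Xc x; exact: pi1_compact.
  move=> V i Oi x.
  have AD : A (defect W i) by exact: defect_mem.
  (* The defect is a norm limit of its products with truncations, and these are killed with the rank
     one operators. *)
  have D0 : singular_rep A pi (defect W i) x = 0.
    apply: (@le_eps_eq0 _ _ _ (2%:R * `|x|)) => [|eps eps0]; first by rewrite mulr_ge0.
    have [N DN] := defect_truncation e_basis W_shift W_inj (mu_lim i Oi) eps0.
    have AT : A (truncation e N) by exact: (cstar_sum A_alg).
    have ADT : A (bop_comp (defect W i) (truncation e N)) by exact: (cstar_comp A_alg).
    have := rep_bounded A_alg pi1_rep (cstar_lin A_alg (-1) ADT AD) eps0 DN x.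
    rewrite (rep_lin pi1_rep)// (rep_comp pi1_rep)// (rep_sum A_alg pi1_rep)//.
    rewrite big1 => [|a _]; last by rewrite pi1_compact//; exact: compact_op_rank1.
    by rewrite linear0 scaler0 add0r mulrCA mulrA.
  have AWW j : A (bop_comp (W j) (adjoint (W j))).
    by apply: (cstar_comp A_alg) => //; exact: (cstar_adjoint A_alg).
  move: D0; rewrite (rep_lin pi1_rep); last 2 first.
  - exact: (cstar_sum A_alg).
  - by apply: (cstar_comp A_alg) => //; exact: (cstar_adjoint A_alg).
  rewrite (rep_sum A_alg pi1_rep)// (rep_comp pi1_rep)//; last exact: (cstar_adjoint A_alg).
  rewrite (rep_adjoint pi1_rep)// scaleN1r addrC => /eqP.
  rewrite subr_eq0 => /eqP VV; apply: etrans VV _.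
  apply: eq_bigr => j _; rewrite (rep_comp pi1_rep)//; last exact: (cstar_adjoint A_alg).
  by rewrite (rep_adjoint pi1_rep).
move=> K K' pi pi' pi0 pi1 pi0' pi1' G G' _ pi_rep pi_sum pi_amp _ pi_rep' pi_sum' pi_amp'.
(* The given ampliations are arbitrary; the isometries identify [G] and [G'] with the ranges of the
   vacuum projections. *)
have [j jK jV] := ampliation_isometry e_basis A_alg A_rank1 pi_rep pi_sum pi_amp.
have [j' jK' jV'] := ampliation_isometry e_basis A_alg A_rank1 pi_rep' pi_sum' pi_amp'.
have pi1E X y := @direct_sum_singularE _ _ _ _ _ _ _ pi_sum X y.
have pi1'E X y := @direct_sum_singularE _ _ _ _ _ _ _ pi_sum' X y.
split=> [pi_eq|[/hdim_eq_unitary[V uV] pi1_eq]].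
  split; last exact: (unitarily_equivalent_singular e_basis A_alg A_rank1 pi_rep pi_rep'
    pi1E pi1'E).
  have [V uV] := unitarily_equivalent_multiplicity A_rank1 jK jV jK' jV' pi_eq.
  exact: unitary_hdim_eq uV.
exact: (unitarily_equivalent_glue e_basis A_alg A_rank1 pi_rep pi_rep'
  pi1E pi1'E jK jV jK' jV' uV pi1_eq).
Qed.
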